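(* Let $A$ be a TDLC group which is compactly generated relative to a finite collection of open subgroups $\mathcal H$. Let $G=A\ast_C$ be an HNN extension of topological groups such that $A$ is hyperbolic relative to $\mathcal H$ and $C$ is compact. Then $G$ is hyperbolic relative to $\mathcal H$.
   Context: All topological groups are Hausdorff. A TDLC group is a totally disconnected locally compact group. All graphs are connected and edges have length one. HNN extension: $C$ is an open subgroup of $A$, $\alpha$ is a topological isomorphism from $C$ onto an open subgroup of $A$, and $G=A\ast_C=\langle A,t\mid t^{-1}ct=\alpha(c)\ \text{for all } c\in C\rangle$. $G$ carries the unique group topology for which the inclusion $A\to G$ is an open topological embedding. Let $G$ be a TDLC group and $\mathcal H$ a finite collection of open subgroups. $G$ is compactly generated relative to $\mathcal H$ if there is a compact $K\subset G$ such that $K\cup\bigcup_{H\in\mathcal H}H$ algebraically generates $G$. $(G,\mathcal H)$ is a proper pair if no two distinct non-compact subgroups in $\mathcal H$ are conjugate in $G$. A Cayley-Abels graph of $G$ with respect to $\mathcal H$ (for a proper pair $(G,\mathcal H)$) is a connected simplicial graph $X$ on which $G$ acts cocompactly and discretely (pointwise stabilizers of cells are open subgroups) such that: (1) edge $G$-stabilizers are compact; (2) vertex $G$-stabilizers are either compact or conjugates of subgroups in $\mathcal H$; (3) every $H\in\mathcal H$ is the $G$-stabilizer of a vertex of $X$; (4) any two vertices of $X$ with the same $G$-stabilizer $H\in\mathcal H$ are in the same $G$-orbit if $H$ is non-compact. A simplicial graph is fine if for any vertices $u,v$ and any $n\in\mathbb N$ there are only finitely many embedded paths of length $n$ from $u$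 to $v$. $G$ is hyperbolic relative to $\mathcal H$ if $(G,\mathcal H)$ is a proper pair and there exists a Cayley-Abels graph of $G$ with respect to $\mathcal H$ that is fine and Gromov hyperbolic. *)

(* Defs.v *)
From HB Require Import structures.
From mathcomp Require Import all_boot all_order all_algebra.
From mathcomp Require Import all_classical topology.

Set Implicit Arguments.
Unset Strict Implicit.
Unset Printing Implicit Defensive.

Import Order.TTheory GRing.Theory Num.Theory.
Local Open Scope classical_set_scope.

HB.mixin Record isTopologicalGroup (G : Type) of Group G & Topological G := {
  mulg_continuous : continuous (fun x : G * G => (x.1 * x.2)%g);
  invg_continuous : continuous (fun x : G => (x^-1)%g)
}.

#[short(type="topologicalGroupType")]
HB.structure Definition TopologicalGroup :=
  {G of Group G & Topological G & isTopologicalGroup G}.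

Section Groups.
Context {G : groupType}.

Definition subgroup (H : set G) : Prop := group_closed [in H].

Definition generated_subgroup (S : set G) : set G := smallest subgroup S.

Definition conjugate (H K : set G) : Prop :=
  exists g : G, K = [set (h ^ g)%g | h in H].

End Groups.

Section TopologicalGroups.
Context {G : topologicalGroupType}.

Definition open_subgroup (H : set G) : Prop := subgroup H /\ open H.

End TopologicalGroups.

(* Topological groups are Hausdorff by convention; the mixin does not impose
   it, so it is part of [tdlc]. *)
Definition tdlc (G : topologicalGroupType) : Prop :=
  [/\ hausdorff_space G,
      totally_disconnected [set: G] &
      locally_compact [set: G]].

Definition compactly_generated_relative (G : topologicalGroupType)
    (HH : set (set G)) : Prop :=
  exists2 K : set G, compact K &
    generated_subgroup (K `|` \bigcup_(H in HH) H) = [set: G].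

(* [alpha] only matters on [C]. *)
Definition topological_isomorphism (A B : topologicalGroupType)
    (C : set A) (D : set B) (alpha : A -> B) : Prop :=
  [/\ {in C &, {morph alpha : x y / (x * y)%g}},
      set_bij C D alpha,
      {within C, continuous alpha} &
      exists2 beta : B -> A,
        {in C, cancel alpha beta} & {within D, continuous beta}].

(* [G], with [i : A -> G] and [t : G], is the HNN extension
   < A, t | t^-1 c t = alpha c for c in C >, the presentation being expressed
   by its universal property, and [G] carries the group topology for which [i]
   is an open topological embedding. *)
Record hnn_extension (A G : topologicalGroupType) (C : set A) (alpha : A -> A)
    (i : {multiplicative A -> G}) (t : G) : Prop := HnnExtension {
  hnn_base : open_subgroup C;
  hnn_image : open_subgroup (alpha @` C);
  hnn_iso : topological_isomorphism C (alpha @` C) alpha;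
  hnn_relation : forall c, C c -> (t^-1 * i c * t)%g = i (alpha c);
  hnn_universal : forall (K : groupType) (f : {multiplicative A -> K}) (s : K),
    (forall c, C c -> (s^-1 * f c * s)%g = f (alpha c)) ->
    exists phi : {multiplicative G -> K},
      [/\ forall a, phi (i a) = f a,
          phi t = s &
          forall psi : {multiplicative G -> K},
            (forall a, psi (i a) = f a) -> psi t = s -> psi =1 phi];
  hnn_injective : injective i;
  hnn_continuous : continuous i;
  hnn_open : forall U : set A, open U -> open (i @` U)
}.

(* A simplicial graph is a symmetric irreflexive relation on its vertices; its
   cells are the sets of vertices [set x] and [set x; y] with x, y adjacent. *)
Section Graphs.
Context {V : choiceType}.
Variable e : rel V.

Definition simplicial : Prop := symmetric e /\ irreflexive e.

Definition walk (n : nat) (x y : V) : Prop :=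
  exists p : seq V, [/\ path e x p, last x p = y & size p = n].

Definition connected_graph : Prop :=
  [set: V] !=set0 /\ forall x y, exists n, walk n x y.

(* The path metric; it takes the junk value 0 on vertices joined by no walk. *)
Definition graph_dist (x y : V) : nat :=
  if pselect (exists n, `[< walk n x y >]) is left w then ex_minn w else 0.

Definition embedded_path (n : nat) (u v : V) (p : seq V) : Prop :=
  [/\ path e u p, last u p = v, uniq (u :: p) & size p = n].

Definition fine : Prop :=
  forall (u v : V) (n : nat), finite_set [set p | embedded_path n u v p].

Definition gromov_product (w x y : V) : rat :=
  (((graph_dist x w)%:R + (graph_dist y w)%:R - (graph_dist x y)%:R) / 2)%R.

Definition gromov_hyperbolic : Prop :=
  exists delta : rat, forall w x y z : V,
    (Num.min (gromov_product w x y) (gromov_product w y z) - delta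
      <= gromov_product w x z)%R.

Definition edges : set (set V) :=
  [set s | exists x y, e x y /\ s = [set x; y]].

Definition cells : set (set V) := range set1 `|` edges.

End Graphs.

Section Actions.
Context {G : topologicalGroupType} {V : choiceType}.
Variables (e : rel V) (act : G -> V -> V).

Definition graph_action : Prop :=
  [/\ forall x, act 1%g x = x,
      forall g h x, act (g * h)%g x = act g (act h x) &
      forall g x y, e (act g x) (act g y) = e x y].

Definition pointwise_stabilizer (s : set V) : set G :=
  [set g | forall x, s x -> act g x = x].

Definition stabilizer (s : set V) : set G := [set g | act g @` s = s].

Definition vertex_stabilizer (x : V) : set G := [set g | act g x = x].

Definition cell_orbit (s : set V) : set (set V) :=
  range (fun g : G => act g @` s).

Definition discrete_action : Prop :=
  forall s, cells e s -> open (pointwise_stabilizer s).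

Definition cocompact_action : Prop := finite_set (cell_orbit @` cells e).

End Actions.

Record proper_pair (G : topologicalGroupType) (HH : set (set G)) : Prop :=
  ProperPair {
  proper_pair_tdlc : tdlc G;
  proper_pair_finite : finite_set HH;
  proper_pair_open : forall H, HH H -> open_subgroup H;
  proper_pair_conj : forall H K, HH H -> HH K -> H <> K ->
    ~ compact H -> ~ compact K -> ~ conjugate H K
}.

Record cayley_abels_graph (G : topologicalGroupType) (HH : set (set G))
    (V : choiceType) (e : rel V) (act : G -> V -> V) : Prop :=
  CayleyAbelsGraph {
  ca_simplicial : simplicial e;
  ca_connected : connected_graph e;
  ca_action : graph_action e act;
  ca_cocompact : cocompact_action e act;
  ca_discrete : discrete_action e act;
  ca_edges : forall s, edges e s -> compact (stabilizer act s);
  ca_vertices : forall x, compact (vertex_stabilizer act x) \/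
    exists2 H, HH H & conjugate H (vertex_stabilizer act x);
  ca_peripheral : forall H, HH H -> exists x, vertex_stabilizer act x = H;
  ca_orbits : forall H x y, HH H -> ~ compact H ->
    vertex_stabilizer act x = H -> vertex_stabilizer act y = H ->
    exists g, y = act g x
}.

Definition relatively_hyperbolic (G : topologicalGroupType)
    (HH : set (set G)) : Prop :=
  proper_pair HH /\
  exists (V : choiceType) (e : rel V) (act : G -> V -> V),
    [/\ cayley_abels_graph HH e act, fine e & gromov_hyperbolic e].

(* Main.v *)
(* Enlarge a Cayley-Abels graph of A by vertices with stabilizers C and
   D = alpha(C), attached to a finite orbit by legs so long that the old graph
   stays isometrically embedded.  Then form the tree of copies G x_A V of this
   graph, joining the vertex g p (stabilizer g C g^-1) of each copy to the vertex
   g t q (stabilizer g t D t^-1 g^-1) of the next one.  Each joining edge cuts the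
   graph, so hyperbolicity passes from the copies to the whole by moving the four
   points across cut edges, and fineness by retracting onto one copy.  The
   Bass-Serre theory needed (the edge at A through which g A is reached) comes
   straight from the universal property, applied to permutation groups of sets
   G * S. *)

(* Since [t D t^-1 = C] in [G], both ends of a joining edge have the same stabilizer. As it is
   exactly [C] at [p] and [D] at [q], the vertex [a p] determines the coset [a C], so vertices of
   one copy can name the edges of the Bass-Serre tree at [A]. Compactness of [C] gives these ends
   finite degree and the joining edges compact stabilizers. The enlarged collection is dropped at
   the end: a Cayley-Abels graph may have any compact vertex stabilizers.

   The obstacle is fineness after attaching legs. A path over the top of a leg has no counterpart in
   the old graph. Replaced by a geodesic between two points of [g C x0], it may run through the very
   vertex [u] that it must avoid. Such passages are translates of finitely many turns, and compact
   edge stabilizers leave finitely many exits for each entrance. Fineness is therefore used in a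
   form that counts neighbours of [u] by walks, not by embedded paths. *)
Require Import Defs.
From HB Require Import structures.
From mathcomp Require Import all_boot all_order all_algebra.
From mathcomp Require Import all_classical topology.
From mathcomp Require Import zify lra.
Local Open Scope classical_set_scope.
Set Implicit Arguments.
Unset Strict Implicit.
Unset Printing Implicit Defensive.
Import Order.TTheory GRing.Theory Num.Theory.
Local Open Scope quotient_scope.

(** * Topological groups and actions on graphs *)

Section Subgroups.
Context {G : groupType} {H : set G} (sgH : subgroup H).

Lemma subgroup1 : H 1%g.
Proof. by case: sgH => + _; rewrite inE. Qed.

Lemma subgroupF x y : H x -> H y -> H (x / y)%g.
Proof. by case: sgH => _ /(_ x y); rewrite !inE; apply. Qed.

Lemma subgroupV x : H x -> H x^-1%g.
Proof. by move=> Hx; rewrite -div1g; apply: subgroupF; first exact: subgroup1. Qed.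

Lemma subgroupM x y : H x -> H y -> H (x * y)%g.
Proof. by move=> Hx Hy; rewrite -[y]invgK; apply/subgroupF/subgroupV. Qed.

Lemma subgroupMr x y : H y -> H (x * y)%g <-> H x.
Proof.
move=> Hy; split; last by move=> Hx; exact: subgroupM.
by move=> /subgroupM/(_ (subgroupV Hy)); rewrite mulgK.
Qed.

End Subgroups.

Lemma subgroup_intro (G : groupType) (H : set G) :
  H 1%g -> (forall x y, H x -> H y -> H (x / y)%g) -> subgroup H.
Proof. by move=> H1 HF; split; [rewrite inE | move=> x y; rewrite !inE; exact: HF]. Qed.

Lemma subgroupI (G : groupType) (H K : set G) :
  subgroup H -> subgroup K -> subgroup (H `&` K).
Proof.
move=> sH sK; apply: subgroup_intro; first by split; exact: subgroup1.
by move=> x y [Hx Kx] [Hy Ky]; split; exact: subgroupF.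
Qed.

Section TopologicalGroups.
Context {G : topologicalGroupType}.
Implicit Types (g : G) (A H K : set G).

Lemma mulgl_continuous g : continuous (fun x : G => g * x)%g.
Proof.
move=> x; have px : (fun y : G => (g, y)) y @[y --> x] --> (g, x).
  by apply: cvg_pair => //; exact: cvg_cst.
exact: (cvg_comp _ _ px (@mulg_continuous G (g, x))).
Qed.

Lemma mulgr_continuous g : continuous (fun x : G => x * g)%g.
Proof.
move=> x; have px : (fun y : G => (y, g)) y @[y --> x] --> (x, g).
  by apply: cvg_pair => //; exact: cvg_cst.
exact: (cvg_comp _ _ px (@mulg_continuous G (x, g))).
Qed.

Lemma preimage_mulgl_open g A : open A -> open [set x | A (g * x)%g].
Proof. by apply: open_comp => x _; exact: mulgl_continuous. Qed.

Lemma preimage_mulgr_open g A : open A -> open [set x | A (x * g)%g].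
Proof. by apply: open_comp => x _; exact: mulgr_continuous. Qed.

Lemma open_of_subgroup A H : open H -> H 1%g ->
  (forall x h, A x -> H h -> A (x * h)%g) -> open A.
Proof.
move=> oH H1 AH; rewrite openE => x Ax.
rewrite /interior nbhsE; exists [set y | H (x^-1 * y)%g].
  by split; [exact: preimage_mulgl_open | rewrite /= mulVg].
by move=> y /= Hy; rewrite -(mulVKg x y); exact: AH.
Qed.

Lemma subgroup_open H K : open_subgroup K -> subgroup H -> K `<=` H -> open H.
Proof.
move=> [sK oK] sH KH; apply: (open_of_subgroup oK) => [|x h Hx /KH Hh].
  exact: subgroup1.
exact: subgroupM.
Qed.

Lemma open_subgroup_closed H : open_subgroup H -> closed H.
Proof.
move=> [sH oH]; rewrite -[H]setCK; apply: open_closedC.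
apply: (open_of_subgroup oH) => [|x h /= nHx Hh]; first exact: subgroup1.
by move=> Hxh; apply: nHx; move: Hxh; rewrite subgroupMr.
Qed.

Lemma compact_image_continuous (T U : topologicalType) (f : T -> U) (S : set T) :
  continuous f -> compact S -> compact (f @` S).
Proof. by move=> cf; apply: continuous_compact; exact: continuous_subspaceT. Qed.

Lemma compact_mulgl g A : compact A -> compact [set (g * x)%g | x in A].
Proof. by apply: compact_image_continuous; exact: mulgl_continuous. Qed.

Lemma compact_conj g A : compact A -> compact [set (x ^ g)%g | x in A].
Proof.
apply: compact_image_continuous => x.
exact: (cvg_comp _ _ (@mulgr_continuous g x) (@mulgl_continuous g^-1%g _)).
Qed.

Lemma open_conj g A : open A -> open [set (x ^ g)%g | x in A].
Proof.
move=> oA; rewrite (_ : image _ _ = [set h | A (g * h * g^-1)%g]).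
  apply: (@preimage_mulgl_open _ [set h | A (h * g^-1)%g]).
  exact: preimage_mulgr_open.
apply/seteqP; split=> [_ [h Ah <-]|h /= Ah].
  by rewrite /conjg /= !mulgA mulgV mul1g mulgK.
by exists (g * h * g^-1)%g; rewrite // /conjg -!mulgA mulVg mulg1 mulKg.
Qed.

(* The sets containing a given finite set form a filter base, so this is the
   finite subcover property without a base point. *)
Lemma finite_compact_image (V : Type) (f : G -> V) A : compact A ->
  (forall g, open [set h | f h = f g]) -> finite_set (f @` A).
Proof.
move=> /compact_near_coveringP cA of_.
pose F : set_system (set V) :=
  [set Z | exists2 S0, finite_set S0 & forall S, S0 `<=` S -> Z S].
have FF : Filter F.
  split.
  - by exists set0.
  - move=> P Q [S fS SP] [S' fS' SQ]; exists (S `|` S').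
      by rewrite finite_setU.
    by move=> R; rewrite subUset => -[? ?]; split; [exact: SP | exact: SQ].
  - by move=> P Q PQ [S fS SP]; exists S => // R /SP /PQ.
case: (cA _ F (fun S g => S (f g)) FF).
  move=> g Ag; exists ([set h | f h = f g], [set S | S (f g)]).
    split => /=; first exact: (open_nbhs_nbhs (conj (of_ g) erefl)).
    by exists [set f g] => //; move=> S; apply.
  by move=> [h S] /= [-> ].
move=> S0 fS0 /(_ S0 (fun x h => h)) S0P; apply: sub_finite_set fS0.
by move=> _ [g /S0P + <-].
Qed.

End TopologicalGroups.

Section GroupActions.
Context {G : topologicalGroupType} {V : choiceType} {act : G -> V -> V}.
Hypothesis act1 : forall x, act 1%g x = x.
Hypothesis actM : forall g h x, act (g * h)%g x = act g (act h x).

Lemma actK g : cancel (act g) (act g^-1%g).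
Proof. by move=> x; rewrite -actM mulVg act1. Qed.

Lemma actKV g : cancel (act g^-1%g) (act g).
Proof. by move=> x; rewrite -actM mulgV act1. Qed.

Lemma vertex_stabilizer_subgroup x : subgroup (vertex_stabilizer act x).
Proof.
apply: subgroup_intro => [|g h /= gx hx]; first exact: act1.
by rewrite /vertex_stabilizer /= actM -[in LHS]hx actK.
Qed.

Lemma vertex_stabilizer_conj g x :
  vertex_stabilizer act (act g x) =
  [set (h ^ g^-1)%g | h in vertex_stabilizer act x].
Proof.
apply/seteqP; split=> [h /= hgx|_ [h hx <-]]; last first.
  by rewrite /vertex_stabilizer /= /conjg invgK actM actM actK hx.
exists (h ^ g)%g; last by rewrite -conjgM mulgV conjg1.
by rewrite /vertex_stabilizer /= /conjg actM actM hgx actK.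
Qed.

Lemma compact_vertex_stabilizer g x : compact (vertex_stabilizer act x) ->
  compact (vertex_stabilizer act (act g x)).
Proof. by rewrite vertex_stabilizer_conj; exact: compact_conj. Qed.

Lemma open_vertex_stabilizer g x : open (vertex_stabilizer act x) ->
  open (vertex_stabilizer act (act g x)).
Proof. by rewrite vertex_stabilizer_conj; exact: open_conj. Qed.

Lemma compact_transporter x y : compact (vertex_stabilizer act x) ->
  compact [set g | act g x = y].
Proof.
move=> cx; have [[g gx]|nxy] := pselect (exists g, act g x = y); last first.
  rewrite (_ : mkset _ = set0); first exact: compact0.
  by apply/seteqP; split=> // g gx; apply: nxy; exists g.
rewrite (_ : mkset _ = [set (g * h)%g | h in vertex_stabilizer act x]).
  exact: compact_mulgl.
apply/seteqP; split=> [h /= hx|_ [h /= hx <-]]; last by rewrite actM hx.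
exists (g^-1 * h)%g; last exact: mulVKg.
by rewrite /vertex_stabilizer /= actM hx -gx actK.
Qed.

Hypothesis act_open : forall x, open (vertex_stabilizer act x).

Lemma finite_orbit A x : compact A -> finite_set [set act g x | g in A].
Proof.
move=> cA; apply: (@finite_compact_image _ _ (act^~ x)) => // g.
rewrite (_ : mkset _ = [set h | vertex_stabilizer act x (g^-1 * h)%g]).
  exact: preimage_mulgl_open.
apply/seteqP; split=> h /=; rewrite /vertex_stabilizer /= actM.
  by move=> ->; rewrite actK.
by move=> {2}<-; rewrite actKV.
Qed.

Lemma vertex_stabilizer_open x : open_subgroup (vertex_stabilizer act x).
Proof. by split; [exact: vertex_stabilizer_subgroup | exact: act_open]. Qed.

Lemma stabilizer_subgroup (s : set V) : subgroup (stabilizer act s).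
Proof.
apply: subgroup_intro => [|g h /= gs hs].
  apply/seteqP; split=> [_ [x sx <-]|x sx]; rewrite ?act1 //.
  by exists x; rewrite ?act1.
rewrite /stabilizer /=; apply/seteqP; split=> [_ [x sx <-]|x].
  move: sx; rewrite -{1}hs => -[y sy <-].
  by rewrite actM actK -gs; exists y.
rewrite -{1}gs => -[y sy <-]; exists (act h y); last by rewrite actM actK.
by rewrite -hs; exists y.
Qed.

Lemma stabilizer2_sub x y : vertex_stabilizer act x `&` vertex_stabilizer act y
  `<=` stabilizer act [set x; y].
Proof.
move=> g [gx gy]; rewrite /stabilizer /=; apply/seteqP.
split=> [_ [z [->|->] <-]|z [->|->]].
- by left.
- by right.
- by exists x; [left|].
- by exists y; [right|].
Qed.

Lemma vertex_stabilizerI_open x y :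
  open_subgroup (vertex_stabilizer act x `&` vertex_stabilizer act y).
Proof.
split; first by apply: subgroupI; exact: vertex_stabilizer_subgroup.
by apply: openI.
Qed.

Lemma stabilizer2_closed x y : closed (stabilizer act [set x; y]).
Proof.
have sS := stabilizer_subgroup [set x; y].
apply: open_subgroup_closed; split=> //.
exact: subgroup_open (vertex_stabilizerI_open x y) sS (@stabilizer2_sub x y).
Qed.

(** [stabilizer] is setwise and an element may swap the ends, hence the transporter from [x] to [y]
    beside the stabilizer of [x]. *)
Lemma compact_stabilizer2 x y : compact (vertex_stabilizer act x) ->
  compact (stabilizer act [set x; y]).
Proof.
move=> cx; apply: (@subclosed_compact _ _
  (vertex_stabilizer act x `|` [set g | act g x = y])).
- exact: stabilizer2_closed.
- exact/compactU/compact_transporter.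
move=> g gxy; have : [set x; y] (act g x) by rewrite -gxy; exists x; [left|].
by case=> [|]; [left|right].
Qed.

(** A nonempty transporter of pairs is a coset of the pointwise stabilizer, which is closed in the
    compact setwise one. Vertex stabilizers may be non-compact; the finiteness of turns rests on
    this. *)
Lemma compact_transporter2 a b x y : compact (stabilizer act [set a; b]) ->
  compact [set g | act g a = x /\ act g b = y].
Proof.
move=> cab.
have [[g [ga gb]]|nxy] := pselect (exists g, act g a = x /\ act g b = y); last first.
  rewrite (_ : mkset _ = set0); first exact: compact0.
  by apply/seteqP; split=> // g gx; apply: nxy; exists g.
rewrite (_ : mkset _ = [set (g * h)%g | h in
  vertex_stabilizer act a `&` vertex_stabilizer act b]).
  apply: compact_mulgl; apply: (subclosed_compact _ cab).
    by apply: open_subgroup_closed; exact: vertex_stabilizerI_open.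
  exact: stabilizer2_sub.
apply/seteqP; split=> [h /= [ha hb]|_ [h /= [ha hb] <-]].
  exists (g^-1 * h)%g; last exact: mulVKg.
  by split; rewrite /vertex_stabilizer /= actM ?ha ?hb -?ga -?gb actK.
by rewrite !actM ha hb.
Qed.

Section OnGraph.
Context {e : rel V}.
Hypothesis actE : forall g x y, e (act g x) (act g y) = e x y.

Lemma discrete_of_open : discrete_action e act.
Proof.
move=> s [[x _ <-]|[x [y [_ ->]]]].
  rewrite (_ : pointwise_stabilizer _ _ = vertex_stabilizer act x) //.
  by apply/seteqP; split=> [g|g gx _ ->] //; apply.
rewrite (_ : pointwise_stabilizer _ _ =
  vertex_stabilizer act x `&` vertex_stabilizer act y); first exact: openI.
apply/seteqP; split=> [g gxy|g [gx gy] z [->|->] //].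
by split; apply: gxy; [left|right].
Qed.

Lemma cell_orbit_act g (s : set V) : cell_orbit act (act g @` s) = cell_orbit act s.
Proof.
apply/seteqP; split=> [_ [h _ <-]|_ [h _ <-]].
  exists (h * g)%g => //; rewrite image_comp; apply: eq_imagel => x _ /=.
  by rewrite actM.
exists (h * g^-1)%g => //; rewrite image_comp; apply: eq_imagel => x _ /=.
by rewrite actM actK.
Qed.

Lemma cocompact_of_finite (R : set V) (E : set (V * V)) :
  finite_set R -> finite_set E ->
  (forall x, exists g a, R a /\ x = act g a) ->
  (forall x y, e x y -> exists g a b, [/\ E (a, b), x = act g a & y = act g b]) ->
  cocompact_action e act.
Proof.
move=> fR fE RP EP.
apply: (@sub_finite_set _ _ ([set cell_orbit act [set a] | a in R] `|`
  [set cell_orbit act [set p.1; p.2] | p in E])); last first.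
  by rewrite finite_setU; split; exact: finite_image.
move=> _ [s [[x _ <-]|[x [y [exy ->]]]] <-].
  have [g [a [Ra ->]]] := RP x; left; exists a => //.
  by rewrite -(cell_orbit_act g) image_set1.
have [g [a [b [Eab -> ->]]]] := EP _ _ exy; right; exists (a, b) => //=.
by rewrite -(cell_orbit_act g) image_setU !image_set1.
Qed.

Lemma set2_eq (x y a b : V) : [set x; y] = [set a; b] ->
  (x = a /\ y = b) \/ (x = b /\ y = a).
Proof.
move=> E.
have : x = a \/ x = b by suff : [set a; b] x by []; rewrite -E; left.
have : y = a \/ y = b by suff : [set a; b] y by []; rewrite -E; right.
have : a = x \/ a = y by suff : [set x; y] a by []; rewrite E; left.
have : b = x \/ b = y by suff : [set x; y] b by []; rewrite E; right.
by case=> ? [] ? [] ? [] ?; subst; auto.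
Qed.

Lemma finite_of_cocompact : cocompact_action e act ->
  (exists2 R, finite_set R & forall x, exists g a, R a /\ x = act g a) /\
  (exists2 E : set (V * V), finite_set E & forall x y, e x y ->
    exists g a b, [/\ E (a, b), x = act g a & y = act g b]).
Proof.
move=> fC.
have /choice [c cP] : forall O, exists s,
    (cell_orbit act @` cells e) O -> cells e s /\ cell_orbit act s = O.
  move=> O.
  have [[s sc <-]|nO] := pselect ((cell_orbit act @` cells e) O); first by exists s.
  by exists set0.
have rep s : cells e s -> exists g, s = act g @` c (cell_orbit act s).
  move=> sc; have [] := cP (cell_orbit act s); first by exists s.
  move=> _ E; have : cell_orbit act s s.
    exists 1%g => //; apply/seteqP; split=> [_ [x sx <-]|x sx]; rewrite ?act1 //.
    by exists x; rewrite ?act1.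
  by rewrite -{1}E => -[g _ gE]; exists g.
split.
  exists [set a | (cell_orbit act @` cells e) (cell_orbit act [set a]) /\
     c (cell_orbit act [set a]) = [set a]].
    apply: (@sub_finite_set _ _ [set a | [set c O | O in cell_orbit act @` cells e] [set a]]).
      by move=> a [aO ca]; exists (cell_orbit act [set a]).
    apply: (@finite_preimage _ _ [set c O | O in cell_orbit act @` cells e] (@set1 V)).
      by move=> a b _ _ E; have : [set a] a by []; rewrite E.
    exact: finite_image.
  move=> x; have xc : cells e [set x] by left; exists x.
  have [g E] := rep _ xc.
  have [a ca] : exists a, c (cell_orbit act [set x]) = [set a].
    have [[a _ <-]|[a [b [_ cE]]]] := (cP (cell_orbit act [set x]) (imageP _ xc)).1.
      by exists a.
    (* Loops are possible here, so the chosen cell may be written as an edge; having a singleton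
       translate, it has [a = b]. *)
    exists a; rewrite cE; move: E; rewrite cE image_setU !image_set1 => E.
    have xa : act g a = x by have : [set x] (act g a) by rewrite E; left.
    have xb : act g b = x by have : [set x] (act g b) by rewrite E; right.
    by rewrite -(actK g b) xb -xa actK setUid.
  exists g, a; rewrite ca image_set1 in E; split.
    have Ex : cell_orbit act [set a] = cell_orbit act [set x].
      by rewrite E -(cell_orbit_act g) image_set1.
    by split; rewrite Ex //; exists [set x].
  by have : [set x] x by []; rewrite {1}E.
exists [set p | [set c O | O in cell_orbit act @` cells e] [set p.1; p.2]].
  pose B := [set c O | O in cell_orbit act @` cells e].
  have fB : finite_set B by exact: finite_image.
  apply: (@sub_finite_set _ _ (\bigcup_(s in B) [set p | s = [set p.1; p.2]])).
    by move=> p Bp; exists [set p.1; p.2].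
  apply: bigcup_finite => // s _.
  have [[p ->]|ns] := pselect (exists p : V * V, s = [set p.1; p.2]); last first.
    apply: (@sub_finite_set _ _ set0) => // p sp; apply: ns; by exists p.
  apply: (@sub_finite_set _ _ [set p; (p.2, p.1)]).
    by move=> [a b] /= /set2_eq [[<- <-]|[<- <-]]; [left|right] => //; case: (p).
  exact: finite_set2.
move=> x y exy; have xc : cells e [set x; y] by right; exists x, y.
have [g E] := rep _ xc.
have Exy : c (cell_orbit act [set x; y]) = [set act g^-1%g x; act g^-1%g y].
  transitivity (act g^-1%g @` [set x; y]); last by rewrite image_setU !image_set1.
  rewrite {2}E image_comp -[LHS]image_id; apply: eq_imagel => z _ /=.
  by rewrite actK.
exists g, (act g^-1%g x), (act g^-1%g y); split; rewrite ?actKV //.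
by exists (cell_orbit act [set x; y]) => //; exists [set x; y].
Qed.

(** A neighbour of [x] is [g b] with [g a = x] for one of finitely many edges [(a, b)]; such [g]
    form a compact set, and compact sets have finite orbits. *)
Lemma finite_degree x : cocompact_action e act ->
  compact (vertex_stabilizer act x) -> finite_set [set y | e x y].
Proof.
move=> /finite_of_cocompact [_ [E fE EP]] cx.
apply: (@sub_finite_set _ _ (\bigcup_(p in E)
  [set act g p.2 | g in [set g | act g p.1 = x]])).
  move=> y /EP [g [a [b [Eab xE yE]]]]; exists (a, b) => //=.
  by exists g.
apply: bigcup_finite => // -[a b] _ /=; apply: finite_orbit.
have [[g ga]|na] := pselect (exists g, act g a = x).
  by apply: compact_transporter; rewrite -(actK g a) ga; exact: compact_vertex_stabilizer.
rewrite (_ : mkset _ = set0); first exact: compact0.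
by apply/seteqP; split=> // g gx; apply: na; exists g.
Qed.

End OnGraph.
End GroupActions.

(** * Walks, hyperbolicity and fineness *)

Section Walks.
Context {V : choiceType} {e : rel V}.
Implicit Types (u v x y z : V) (m n k : nat).

Lemma walk0 x y : walk e 0 x y <-> x = y.
Proof.
split=> [[p [_ <- /size0nil ->]] //|<-]; by exists [::].
Qed.

Lemma walkS n x y : walk e n.+1 x y <-> exists z, e x z /\ walk e n z y.
Proof.
split=> [[[|z p] [//= /andP [xz zp] <- [<-]]]|[z [xz [p [zp <- <-]]]]].
  by exists z; split=> //; exists p.
by exists (z :: p); rewrite /= xz.
Qed.

Lemma walk1 x y : walk e 1 x y <-> e x y.
Proof.
rewrite walkS; split=> [[z [+ /walk0 <-]] //|xy].
by exists y; split=> //; exact/walk0.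
Qed.

Lemma walk_cat m n x y z : walk e m x y -> walk e n y z -> walk e (m + n) x z.
Proof.
move=> [p [xp py <-]] [q [yq qz <-]]; exists (p ++ q).
by rewrite cat_path last_cat size_cat py xp yq.
Qed.

Lemma walkSr n x y : walk e n.+1 x y <-> exists z, walk e n x z /\ e z y.
Proof.
split=> [[p [+ + Sp]]|[z [xz /walk1 zy]]]; last first.
  by rewrite -addn1; exact: walk_cat zy.
case/lastP: p Sp => // p w; rewrite size_rcons => -[pn].
rewrite rcons_path last_rcons => /andP [xp pw] <-.
by exists (last x p); split=> //; exists p.
Qed.

Lemma walk_ind_r (P : nat -> V -> Prop) x : P 0 x ->
  (forall n y z, walk e n x y -> P n y -> e y z -> P n.+1 z) ->
  forall n y, walk e n x y -> P n y.
Proof.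
move=> P0 PS; elim=> [y /walk0 <- //|n IH y /walkSr [z [xz zy]]].
exact: PS xz (IH _ xz) zy.
Qed.

Lemma dist_le n x y : walk e n x y -> graph_dist e x y <= n.
Proof.
move=> w; rewrite /graph_dist; case: pselect => [E|//].
by case: ex_minnP => m _; apply; exact/asboolP.
Qed.

Lemma dist_xx x : graph_dist e x x = 0.
Proof. by apply/eqP; rewrite -leqn0; apply: dist_le; exact/walk0. Qed.

Lemma dist_edge x y : e x y -> graph_dist e x y <= 1.
Proof. by move=> /walk1 /dist_le. Qed.

Hypothesis conn_e : connected_graph e.

Lemma dist_walk x y : walk e (graph_dist e x y) x y.
Proof.
rewrite /graph_dist; case: pselect => [E|nE]; last first.
  by case: nE; have [n w] := conn_e.2 x y; exists n; exact/asboolP.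
by case: ex_minnP => m /asboolP.
Qed.

Lemma dist_tri y x z : graph_dist e x z <= graph_dist e x y + graph_dist e y z.
Proof. by apply: dist_le; apply: walk_cat; exact: dist_walk. Qed.

Hypothesis syme : symmetric e.

Lemma walk_sym n x y : walk e n x y -> walk e n y x.
Proof.
elim: n x y => [x y /walk0 ->|n IH x y /walkS [z [xz zy]]]; first exact/walk0.
by apply/walkSr; exists z; rewrite syme; split=> //; exact: IH.
Qed.

Lemma dist_sym x y : graph_dist e x y = graph_dist e y x.
Proof.
by apply/eqP; rewrite eqn_leq; apply/andP; split; apply: dist_le;
  apply: walk_sym; exact: dist_walk.
Qed.

End Walks.

Lemma walk_map (V W : choiceType) (e : rel V) (d : rel W) (f : V -> W) :
  (forall x y, e x y -> d (f x) (f y)) ->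
  forall n x y, walk e n x y -> walk d n (f x) (f y).
Proof.
move=> ed; elim=> [x y /walk0 ->|n IH x y /walkS [z [xz zy]]]; first by apply/walk0.
by apply/walkS; exists (f z); split; [exact: ed | exact: IH].
Qed.

(** The Gromov product inequality at base point [w], doubled and freed of subtraction; [c] stands
    for twice delta. *)
Definition four_point (V : choiceType) (e : rel V) (c : nat) (w x y z : V) :=
  graph_dist e x z + graph_dist e y w <=
    maxn (graph_dist e x y + graph_dist e z w)
         (graph_dist e y z + graph_dist e x w) + c.

Lemma hyperbolicP (V : choiceType) (e : rel V) :
  gromov_hyperbolic e <-> exists c, forall w x y z, four_point e c w x y z.
Proof.
split=> [[d dP]|[c cP]].
  have [n nd] : exists n : nat, (2 * d <= n%:R :> rat)%R.
    exists (Num.bound `|2 * d|)%R.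
    by apply: le_trans (ler_norm _) _; apply/ltW/archi_boundP.
  exists n => w x y z; have := dP w x y z; rewrite /gromov_product /four_point.
  move: (graph_dist e x w) (graph_dist e y w) (graph_dist e z w)
    (graph_dist e x y) (graph_dist e y z) (graph_dist e x z) => a b c f g h.
  rewrite -(ler_nat rat) natrD.
  rewrite minElt; case: ifP => _ H.
    apply: (@le_trans _ _ ((f + c)%:R + n%:R)%R); last first.
      by rewrite -natrD ler_nat leq_add2r leq_maxl.
    by rewrite !natrD; lra.
  apply: (@le_trans _ _ ((g + a)%:R + n%:R)%R); last first.
    by rewrite -natrD ler_nat leq_add2r leq_maxr.
  by rewrite !natrD; lra.
exists c%:R%R => w x y z; have := cP w x y z; rewrite /gromov_product /four_point.
move: (graph_dist e x w) (graph_dist e y w) (graph_dist e z w)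
    (graph_dist e x y) (graph_dist e y z) (graph_dist e x z) => a b d f g h H.
have c0 : (0 <= c%:R :> rat)%R by exact: ler0n.
have [fg|/ltnW fg] := leqP (f + d) (g + a).
  rewrite (maxn_idPr fg) in H.
  move: H; rewrite -(ler_nat rat) !natrD => H.
  set q := (Y in Num.min _ Y); have : (Num.min ((a%:R + b%:R - f%:R) / 2) q <= q)%R.
    by rewrite ge_min lexx orbT.
  by move: (Num.min _ _) => m; rewrite /q; lra.
rewrite (maxn_idPl fg) in H.
move: H; rewrite -(ler_nat rat) !natrD => H.
set p := (X in Num.min X _); have : (Num.min p ((b%:R + d%:R - g%:R) / 2) <= p)%R.
  by rewrite ge_min lexx.
by move: (Num.min _ _) => m; rewrite /p; lra.
Qed.

(* A coarsely dense isometric embedding transports hyperbolicity directly from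
   the four point condition, without any stability of quasi-geodesics. *)
Lemma hyperbolic_dense (V W : choiceType) (e : rel V) (d : rel W) (f : V -> W) (R : nat) :
  connected_graph d -> symmetric d ->
  (forall x y, graph_dist d (f x) (f y) = graph_dist e x y) ->
  (forall z, exists x, graph_dist d (f x) z <= R) ->
  gromov_hyperbolic e -> gromov_hyperbolic d.
Proof.
move=> cd sd iso dense /hyperbolicP [c cP]; apply/hyperbolicP.
(* A distance changes by at most [2 * R], hence a sum of two by [4 * R], on each side of the
   inequality. *)
exists (c + 8 * R) => w x y z.
have [w' w'P] := dense w; have [x' x'P] := dense x.
have [y' y'P] := dense y; have [z' z'P] := dense z.
have near a a' b b' : graph_dist d (f a') a <= R -> graph_dist d (f b') b <= R ->
    graph_dist d a b <= graph_dist e a' b' + 2 * R /\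
    graph_dist e a' b' <= graph_dist d a b + 2 * R.
  move=> aR bR; rewrite -iso.
  have := dist_tri cd (f a') a b; have := dist_tri cd (f b') (f a') b.
  have := dist_tri cd a (f a') (f b'); have := dist_tri cd b a (f b').
  rewrite (dist_sym cd sd a (f a')) (dist_sym cd sd b (f b')); lia.
have := cP w' x' y' z'; rewrite /four_point.
have [] := near _ _ _ _ x'P z'P; have [] := near _ _ _ _ y'P w'P.
have [] := near _ _ _ _ x'P y'P; have [] := near _ _ _ _ z'P w'P.
have [] := near _ _ _ _ y'P z'P; have [] := near _ _ _ _ x'P w'P.
lia.
Qed.

(** * Cut edges and the four point condition *)

Section CutEdges.
Context {V : choiceType} {e : rel V}.
Hypotheses (conn_e : connected_graph e) (syme : symmetric e).
Local Notation d := (graph_dist e).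

Definition cuts (h : pred V) := forall x x' y y', e x x' -> e y y' ->
  h x -> ~~ h x' -> h y -> ~~ h y' -> x = y /\ x' = y'.

(** Every walk out of [h] leaves it through the one edge from [u] to [v], so all distances across
    split there. *)
Lemma dist_cut h x y : cuts h -> h x -> ~~ h y ->
  exists u v, [/\ h u, ~~ h v & forall a b, h a -> ~~ h b ->
    d a b = d a u + (1 + d v b)].
Proof.
move=> ch hx hy.
have crossing n a b : walk e n a b -> h a -> ~~ h b -> exists u v m m',
    [/\ h u, ~~ h v & e u v] /\ [/\ walk e m a u, walk e m' v b & n = m + m'.+1].
  elim: n a => [a /walk0 -> ->//|n IH a /walkS [z [az zb]] ha hb].
  have [hz|hz] := boolP (h z).
    have [u [v [m [m' [? [? ? ->]]]]]] := IH _ zb hz hb.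
    exists u, v, m.+1, m'; do !split=> //.
    by apply/walkS; exists z.
  by exists a, z, 0, n; split; split=> //; exact/walk0.
have [u [v [_ [_ [[hu hv uv] _]]]]] := crossing _ _ _ (dist_walk conn_e x y) hx hy.
exists u, v; split=> // a b ha hb; apply/eqP; rewrite eqn_leq; apply/andP; split.
  apply: leq_trans (dist_tri conn_e u a b) _; rewrite leq_add2l.
  apply: leq_trans (dist_tri conn_e v u b) _; rewrite leq_add2r.
  exact: dist_edge.
have [u' [v' [m [m' [[hu' hv' uv'] [au vb E]]]]]] :=
  crossing _ _ _ (dist_walk conn_e a b) ha hb.
have [uE vE] := ch _ _ _ _ uv uv' hu hv hu' hv'.
move: (dist_le au) (dist_le vb); rewrite -uE -vE; lia.
Qed.

(* If a cut edge isolates one of the four points, that point can be moved to the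
   far end of the edge, which shifts the three sums equally; if it splits the
   points two by two, the two larger sums agree. *)
Lemma hyperbolic_cuts (B : V -> V -> Prop) :
  (forall x y, ~ B x y -> exists2 h, cuts h & h x != h y) ->
  (exists c, forall w x y z, B w x -> B w y -> B w z -> four_point e c w x y z) ->
  gromov_hyperbolic e.
Proof.
move=> Bcut [c cP]; apply/hyperbolicP; exists c => w x y z.
(* Induction on the sum of the six distances: moving an isolated point over the cut edge shortens
   its three distances. *)
have [n] := ubnP (d w x + d w y + d w z + d x y + d x z + d y z).
elim: n w x y z => // n IH w x y z lt_n.
have symd := dist_sym conn_e syme.
have cutP h : cuts h -> ~~ [&& h w == h x, h w == h y & h w == h z] ->
    four_point e c w x y z.
  move=> ch hwxyz.
  have [a [b [ha hb]]] : exists a b, h a /\ ~~ h b.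
    have [hw|hw] := boolP (h w); [exists w | have := hwxyz].
      move: hwxyz; rewrite hw.
      by case hx : (h x); [case hy : (h y); [case hz : (h z) => // |]|];
        [exists z|exists y|exists x]; rewrite ?hx ?hy ?hz.
    rewrite (negPf hw).
    by case hx : (h x); [exists x, w|case hy : (h y); [exists y, w|
      case hz : (h z); [exists z, w|]]].
  have [u [v [hu hv uv]]] := dist_cut ch ha hb.
  have pair p q : if h p then (if h q then d p q <= d p u + d q u
      else d p q == d p u + (1 + d v q)) else
      (if h q then d p q == d q u + (1 + d v p) else d p q <= d v p + d v q).
    case: ifP => hp; case: ifP => hq.
    - by rewrite (symd q u); exact: dist_tri.
    - by apply/eqP/uv; rewrite ?hq.
    - by rewrite symd; apply/eqP/uv; rewrite ?hp.
    - by rewrite (symd v p); exact: dist_tri.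
  have := pair w x; have := pair w y; have := pair w z.
  have := pair x y; have := pair x z; have := pair y z.
  move: lt_n hwxyz; rewrite /four_point.
  rewrite (symd y w) (symd z w) (symd x w).
  have IHw p := IH p x y z; have IHx p := IH w p y z.
  have IHy p := IH w x p z; have IHz p := IH w x y p.
  move: (IHw u) (IHw v) (IHx u) (IHx v) (IHy u) (IHy v) (IHz u) (IHz v).
  rewrite /four_point (symd z w) (symd x w) (symd y w).
  rewrite (symd u x) (symd u y) (symd u z) (symd x v) (symd y v) (symd z v).
  rewrite (symd u w) (symd w v).
  (* Constant patterns contradict [hwxyz]; a two by two split needs only [pair]; otherwise the
     induction hypothesis is used at the isolated point, moved to [v] if it lies in [h] and to [u]
     if not. *)
  case: (h w); case: (h x); case: (h y); case: (h z) => //=;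
    move=> Hwu Hwv Hxu Hxv Hyu Hyv Hzu Hzv lt_n Hyz Hxz Hxy Hwz Hwy Hwx;
    first [clear -lt_n Hyz Hxz Hxy Hwz Hwy Hwx; lia
      | clear -Hwu Hwv lt_n Hyz Hxz Hxy Hwz Hwy Hwx; lia
      | clear -Hxu Hxv lt_n Hyz Hxz Hxy Hwz Hwy Hwx; lia
      | clear -Hyu Hyv lt_n Hyz Hxz Hxy Hwz Hwy Hwx; lia
      | clear -Hzu Hzv lt_n Hyz Hxz Hxy Hwz Hwy Hwx; lia].
have [Bx|/Bcut [h ch hwx]] := pselect (B w x); last first.
  by apply: cutP ch _; rewrite (negPf hwx).
have [By|/Bcut [h ch hwy]] := pselect (B w y); last first.
  by apply: cutP ch _; rewrite (negPf hwy) andbF.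
have [Bz|/Bcut [h ch hwz]] := pselect (B w z); last first.
  by apply: cutP ch _; rewrite (negPf hwz) !andbF.
exact: cP.
Qed.

End CutEdges.

(** * Fineness as local finiteness of angles *)

Section Fineness.
Context {V : choiceType} (e : rel V).

Definition del (u : V) : rel V := [rel x y | [&& e x y, x != u & y != u]].

(** Bowditch's criterion. Being about walks, it survives maps that do not keep paths embedded, such
    as the retraction and the detours below. *)
Definition locally_fine := forall u v n, u <> v ->
  finite_set [set x | e u x /\ exists2 m, m <= n & walk (del u) m x v].

Lemma del_path_notin u x p : path (del u) x p -> u \notin p.
Proof.
elim: p x => //= y p IH x /andP [/and3P [_ _ yu] /IH].
by rewrite inE eq_sym (negPf yu).
Qed.

Lemma walk_del_end u n x y : walk (del u) n x y -> y != u -> x != u.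
Proof. by case: n => [/walk0 ->|n /walkS [z [/and3P []]]]. Qed.

Lemma fineP : fine e <-> locally_fine.
Proof.
split=> [fe u v n uv|lf u v n].
  (* The walk shortens to a path of length at most [n], and the edge from [u] adds one. *)
  apply: (@sub_finite_set _ _ (\bigcup_(k in `I_n.+2)
      [set head u p | p in [set p | embedded_path e k u v p]])); last first.
    by apply: bigcup_finite => // k _; apply: finite_image; exact: fe.
  move=> x [ux [m mn w]]; have xu : x != u.
    by apply: walk_del_end w _; apply/eqP => E; exact: uv.
  case: w => p [xp pv pm].
  case/shortenP: xp pv => q xq uq sqp qv.
  have sq : size q <= n.
    by apply: leq_trans mn; rewrite -pm; apply: uniq_leq_size => //; case/andP: uq.
  exists (size q).+1 => //; exists (x :: q) => //; split=> //.
    rewrite /= ux; apply: sub_path xq => a b; by case/and3P.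
  by rewrite cons_uniq uq andbT inE negb_or eq_sym xu (del_path_notin xq).
elim: n u v => [|n IH] u v.
  by apply: (@sub_finite_set _ _ [set [::]]) => // p [_ _ _ /size0nil].
have [<-|uv] := pselect (u = v).
  apply: (@sub_finite_set _ _ set0) => // -[|x p] [] // _ <- /=.
  by rewrite mem_last.
apply: (@sub_finite_set _ _ (\bigcup_(x in
    [set x | e u x /\ exists2 m, m <= n & walk (del u) m x v])
    [set x :: p | p in [set p | embedded_path e n x v p]])); last first.
  by apply: bigcup_finite; [exact: lf | move=> x _; apply: finite_image; exact: IH].
move=> [|x p] [//= /andP [ux xp] pv /andP [uxp unq] [pn]].
exists x; last by exists p.
split=> //; exists n => //; exists p; split=> //.
move: uxp xp; clear -x; elim: p x => //= y p IH x.
rewrite !inE !negb_or => /and3P [ux uy up] /andP [xy yp].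
rewrite /del /= xy ![_ == u]eq_sym ux uy /=; apply: IH => //.
by rewrite inE negb_or uy.
Qed.

Section Turns.
Variables (u : V) (T : V -> V -> Prop) (St : set V).

(* Walks from [St] that may pass through [u], but only by a turn in [T]; they
   never end at [u]. *)
Inductive turning : nat -> V -> Prop :=
| turning0 n v : St v -> v <> u -> turning n v
| turning_step n x y : turning n x -> e x y -> y <> u -> turning n.+1 y
| turning_turn n s s' : turning n s -> e s u -> T s s' -> s' <> u ->
    turning n.+1 s'.

Lemma turning_le n m x : turning n x -> n <= m -> turning m x.
Proof.
move=> t; elim: t m => {n x} [n v Sv vu m _|n x y _ IH xy yu|n s s' _ IH su ss su'].
- exact: turning0.
- by case=> // m /IH t; exact: turning_step xy yu.
- by case=> // m /IH t; exact: turning_turn su ss su'.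
Qed.

Lemma turning_neq n x : turning n x -> x <> u.
Proof. by case. Qed.

(** Cut at the last turn: what follows avoids [u], what precedes has a strictly smaller bound. *)
Lemma turning_last n x : turning n x ->
  (exists v m, [/\ St v, v <> u, m <= n & walk (del u) m v x]) \/
  (exists m s v k, [/\ m < n, turning m s, e s u & T s v] /\
    [/\ v <> u, k <= n & walk (del u) k v x]).
Proof.
elim=> {n x} [n v Sv vu|n x y tx IH xy yu|n s s' ts _ su ss su'].
- by left; exists v, 0; split=> //; exact/walk0.
- have xy' : del u x y.
    by apply/and3P; split=> //; apply/eqP => //; exact: turning_neq tx.
  case: IH => [[v [m [Sv vu mn w]]]|[m [s [v [k [[mn ts su Tv] [vu kn w]]]]]]].
    by left; exists v, m.+1; split=> //; apply/walkSr; exists x.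
  right; exists m, s, v, k.+1; split; split=> //; first exact: ltnW.
  by apply/walkSr; exists x.
- right; exists n, s, s', 0; split; split=> //; exact/walk0.
Qed.

Hypotheses (lf : locally_fine) (syme : symmetric e).
Hypotheses (finT : forall s, e s u -> finite_set [set s' | T s s']).
Hypothesis finSt : finite_set St.

Lemma del_sym : symmetric (del u).
Proof. by move=> x y; rewrite /del /= syme; congr (_ && _); exact: andbC. Qed.

(** Strong induction: the entrance of the last turn is one of finitely many, [T] leaves finitely
    many exits, and from each exit (or start) local fineness bounds the neighbours of [u]
    reached. *)
Lemma finite_turning n : finite_set [set s | turning n s /\ e s u].
Proof.
elim/ltn_ind: n => n IH.
pose F v := [set s | e u s /\ exists2 m, m <= n & walk (del u) m s v].
apply: (@sub_finite_set _ _ ((\bigcup_(v in St `&` [set v | v <> u]) F v) `|`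
    \bigcup_(m in `I_n) \bigcup_(s in [set s | turning m s /\ e s u])
      \bigcup_(v in [set v | T s v] `&` [set v | v <> u]) F v)).
  move=> s [/turning_last
    [[v [m [Sv vu mn w]]]|[m [s1 [v [k [[mn ts su Tv] [vu kn w]]]]]]] es].
    left; exists v => //; split; first by rewrite syme.
    by exists m => //; apply: walk_sym => //; exact: del_sym.
  right; exists m => //; exists s1 => //; exists v => //; split; first by rewrite syme.
  by exists k => //; apply: walk_sym => //; exact: del_sym.
rewrite finite_setU; split.
  apply: bigcup_finite => [|v [_ vu]]; last by apply: lf => /esym.
  exact: sub_finite_set finSt.
apply: bigcup_finite => // m mn; apply: bigcup_finite => [|s [_ su]]; first exact: IH.
apply: bigcup_finite => [|v [_ vu]]; last by apply: lf => /esym.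
by apply: sub_finite_set (finT su).
Qed.

Variable Q : set V.
Hypothesis QT : forall s s', e s u -> e u s' -> Q s -> Q u -> Q s' -> T s s'.
Hypothesis irre : irreflexive e.

Lemma turning_path n a p : turning n a -> path e a p ->
  (forall x, x \in a :: p -> Q x) -> last a p <> u ->
  turning (n + size p) (last a p).
Proof.
(* A passage through [u] consumes two edges of [p] but counts as one turn, so the induction is on a
   bound for the length. *)
have [k] := ubnP (size p); elim: k n a p => // k IH n a [|b p] /=.
  by rewrite addn0.
move=> pk ta /andP [ab bp] Qp lu.
have [bu|/eqP bu] := eqVneq b u; last first.
  rewrite addnS -addSn; apply: IH => //; first exact: turning_step ab bu.
  by move=> x xp; apply: Qp; rewrite inE xp orbT.
subst b; case: p pk bp Qp lu => //= c p pk /andP [uc cp] Qp lu.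
rewrite !addnS -!addSn; apply: IH => //; first by exact: ltnW.
  apply: (@turning_le n.+1) => //; apply: (turning_turn ta ab).
    by apply: QT => //; apply: Qp; rewrite !inE eqxx ?orbT.
  by move=> E; rewrite E irre in uc.
by move=> x xp; apply: Qp; rewrite !inE in xp *; case/orP: xp => ->; rewrite ?orbT.
Qed.

(** The path is stopped just before its first visit to [u], where [turning] still applies. *)
Lemma turning_hit n a p : turning n a -> path e a p ->
  (forall x, x \in a :: p -> Q x) -> last a p = u ->
  exists s, [/\ turning (n + size p) s, e s u & Q s].
Proof.
elim: p n a => [|b p IH] n a ta /=; first by move=> _ _ /(turning_neq ta).
move=> /andP [ab bp] Qp lu; have [bu|/eqP bu] := eqVneq b u.
  exists a; split; rewrite -?bu //; last by apply: Qp; rewrite inE eqxx.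
  by apply: turning_le ta _; exact: leq_addr.
rewrite addnS -addSn; apply: IH bp _ lu; first exact: turning_step ab bu.
by move=> x xp; apply: Qp; rewrite inE xp orbT.
Qed.

End Turns.
End Fineness.

(** * Adding a compact open subgroup to the peripheral collection *)

Lemma invMVg (G : groupType) (x y : G) : ((x^-1 * y)^-1 = y^-1 * x)%g.
Proof. by rewrite invgM invgK. Qed.

(** Open stabilizers make the orbit of a compact set finite. The bound [L] becomes the height of the
    legs. *)
Lemma compact_bounded_orbit (G : topologicalGroupType) (V : choiceType)
    (e : rel V) (act : G -> V -> V) (C : set G) (x : V) :
  (forall y, act 1%g y = y) -> (forall g h y, act (g * h)%g y = act g (act h y)) ->
  (forall y, open (vertex_stabilizer act y)) -> compact C ->
  exists L, forall c, C c -> graph_dist e x (act c x) <= L.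
Proof.
move=> act1 actM act_open cC.
have /finite_seqP [s sE] : finite_set [set act c x | c in C].
  exact: (finite_orbit act1 actM act_open).
exists (\max_(y <- s) graph_dist e x y) => c Cc.
apply: (leq_bigmax_seq (F := fun y => graph_dist e x y)) => //.
suff : [set` s] (act c x) by [].
by rewrite -sE; exists c.
Qed.

(** One geodesic is fixed for each pair of points of [F]. Translates of [P] later carry the detours
    that replace passages over the top of a leg. *)
Lemma finite_hull (V : choiceType) (e : rel V) (F : set V) (L : nat) :
  connected_graph e -> finite_set F ->
  (forall x y, F x -> F y -> graph_dist e x y <= L) ->
  exists2 P, finite_set P & forall x y, F x -> F y ->
    exists p, [/\ path e x p, last x p = y, size p <= L & forall z, z \in x :: p -> P z].
Proof.
move=> ce fF FL.
have /choice [p pP] : forall xy : V * V, exists p, [/\ path e xy.1 p,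
    last xy.1 p = xy.2 & size p = graph_dist e xy.1 xy.2].
  by move=> [x y]; exact: dist_walk.
exists (\bigcup_(x in F) \bigcup_(y in F) [set` x :: p (x, y)]).
  apply: bigcup_finite => // x _; apply: bigcup_finite => // y _.
move=> x y Fx Fy; exists (p (x, y)); have [/= xp py sp] := pP (x, y).
split=> //; first by rewrite sp FL.
by move=> z zp; exists x => //; exists y.
Qed.

Section Coning.
Context {G : topologicalGroupType} {V : choiceType}.
Variables (e : rel V) (act : G -> V -> V) (C : set G) (x0 : V) (L : nat).
Hypothesis act1 : forall x, act 1%g x = x.
Hypothesis actM : forall g h x, act (g * h)%g x = act g (act h x).
Hypothesis actE : forall g x y, e (act g x) (act g y) = e x y.
Hypothesis act_open : forall x, open (vertex_stabilizer act x).
Hypotheses (oC : open_subgroup C) (cC : compact C).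
Hypotheses (syme : symmetric e) (irre : irreflexive e) (conn_e : connected_graph e).

(* The legs from the points of [C x0] are disjoint below height [L], and those
   of a coset of [C] meet in one vertex at height [L]. *)
Definition leg_group (k : nat) : set G :=
  if k < L then C `&` vertex_stabilizer act x0 else C.

Lemma leg_group_open k : open_subgroup (leg_group k).
Proof.
rewrite /leg_group; case: ifP => _ //; split.
  by apply: subgroupI; [case: oC | exact: vertex_stabilizer_subgroup].
by apply: openI; [case: oC | ].
Qed.

Lemma leg_group_compact k : compact (leg_group k).
Proof.
rewrite /leg_group; case: ifP => _ //; apply: compact_closedI => //.
by apply: open_subgroup_closed; exact: vertex_stabilizer_open.
Qed.

Lemma leg_group_sub k : leg_group k `<=` C.
Proof. by rewrite /leg_group; case: ifP => _ // g []. Qed.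

Lemma leg_group_fix k g : k < L -> leg_group k g -> act g x0 = x0.
Proof. by rewrite /leg_group => -> []. Qed.

Lemma subgroupC : subgroup C. Proof. by case: oC. Qed.

Definition leg_eq (p q : G * 'I_L.+1) : bool :=
  (p.2 == q.2) && `[< leg_group p.2 (p.1^-1 * q.1)%g >].

Lemma leg_eq_refl : reflexive leg_eq.
Proof.
move=> p; rewrite /leg_eq eqxx mulVg /=; apply/asboolP.
by apply: subgroup1; case: (leg_group_open p.2).
Qed.

Lemma leg_eq_sym : symmetric leg_eq.
Proof.
suff imp p q : leg_eq p q -> leg_eq q p by move=> p q; apply/idP/idP; exact: imp.
case: p q => [g k] [h l] /andP [/= /eqP <- /asboolP H]; rewrite /leg_eq /= eqxx /=.
apply/asboolP; rewrite -invMVg; apply: subgroupV H.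
by case: (leg_group_open k).
Qed.

Lemma leg_eq_trans : transitive leg_eq.
Proof.
move=> [h l] [g k] [f m] /andP [/= /eqP -> /asboolP H] /andP [/= /eqP <- /asboolP H'].
rewrite /leg_eq /= eqxx /=; apply/asboolP.
rewrite (_ : (g^-1 * f)%g = (g^-1 * h * (h^-1 * f))%g); last by rewrite -mulgA mulVKg.
by apply: subgroupM => //; case: (leg_group_open l).
Qed.

Canonical leg_equiv := EquivRel leg_eq leg_eq_refl leg_eq_sym leg_eq_trans.

Definition leg_vertex := {eq_quot leg_equiv}.
HB.instance Definition _ := Choice.on leg_vertex.

Definition leg (g : G) (k : nat) : leg_vertex := \pi_leg_vertex (g, inord k).
Arguments leg g%_group_scope k%_nat_scope.

Lemma legP g k h l : k <= L -> l <= L ->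
  leg g k = leg h l <-> k = l /\ leg_group k (g^-1 * h)%g.
Proof.
move=> kL lL; split=> [/eqmodP /andP [/= /eqP E /asboolP]|[<- H]].
  by move/(congr1 val): E; rewrite /= !inordK // => -> ?.
by apply/eqmodP; rewrite /leg_equiv /= /leg_eq /= eqxx /= inordK //; exact/asboolP.
Qed.

Lemma leg_surj q : exists g k, k <= L /\ q = leg g k.
Proof.
rewrite -[q]reprK; case: (repr q) => g k; exists g, k; split; first exact: leq_ord.
by rewrite /leg inord_val.
Qed.

Lemma leg_coset g k h l : k <= L -> l <= L -> leg g k = leg h l ->
  [/\ k = l, C (g^-1 * h)%g, C (h^-1 * g)%g & k < L -> act g x0 = act h x0].
Proof.
move=> kL lL /legP [] // kl H; have CH := leg_group_sub H; split=> //.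
  by rewrite -invMVg; apply: subgroupV CH; exact: subgroupC.
move=> lt_k; rewrite -[h](mulVKg g) actM; congr (act g _); symmetry.
exact: leg_group_fix H.
Qed.

Definition leg_act (g : G) (q : leg_vertex) : leg_vertex :=
  leg (g * (repr q).1) (repr q).2.

Lemma leg_actE g h k : k <= L -> leg_act g (leg h k) = leg (g * h) k.
Proof.
move=> kL; rewrite /leg_act; set p := repr _.
have E : leg p.1 p.2 = leg h k.
  by rewrite -[RHS]reprK -/p; case: (p) => a b; rewrite /leg inord_val.
have /legP [] // := E; first exact: leq_ord.
move=> kE H; apply/legP => //; first exact: leq_ord.
by split=> //; rewrite invgM -mulgA mulKg.
Qed.

Definition cone_vertex := (V + leg_vertex)%type.
HB.instance Definition _ := Choice.on cone_vertex.

(** Height 0 is already one edge away from [V], so a leg reaches its top, at height [L], after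
    [L + 1] edges. *)
Definition attach (x : V) (q : leg_vertex) := exists g, x = act g x0 /\ q = leg g 0.

Definition rung (q q' : leg_vertex) :=
  exists g k, [/\ k < L, q = leg g k & q' = leg g k.+1].

Definition cone_edge : rel cone_vertex := fun a b =>
  match a, b with
  | inl x, inl y => e x y
  | inl x, inr q => `[< attach x q >]
  | inr q, inl x => `[< attach x q >]
  | inr q, inr q' => `[< rung q q' \/ rung q' q >]
  end.

Definition cone_act (g : G) (a : cone_vertex) : cone_vertex :=
  match a with inl x => inl (act g x) | inr q => inr (leg_act g q) end.

Lemma cone_act1 a : cone_act 1%g a = a.
Proof.
case: a => [x|q] /=; first by rewrite act1.
by have [g [k [kL ->]]] := leg_surj q; rewrite leg_actE // mul1g.
Qed.

Lemma cone_actM g h a : cone_act (g * h)%g a = cone_act g (cone_act h a).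
Proof.
case: a => [x|q] /=; first by rewrite actM.
by have [f [k [kL ->]]] := leg_surj q; rewrite !leg_actE // mulgA.
Qed.

Lemma cone_act_attach g x q : attach x q -> attach (act g x) (leg_act g q).
Proof.
by move=> [h [-> ->]]; exists (g * h)%g; rewrite actM leg_actE.
Qed.

Lemma cone_act_rung g q q' : rung q q' -> rung (leg_act g q) (leg_act g q').
Proof.
by move=> [h [k [kL -> ->]]]; exists (g * h)%g, k; rewrite !leg_actE // ltnW.
Qed.

Lemma cone_actE g a b : cone_edge (cone_act g a) (cone_act g b) = cone_edge a b.
Proof.
suff imp h x y : cone_edge x y -> cone_edge (cone_act h x) (cone_act h y).
  apply/idP/idP; last exact: imp.
  by move=> /(imp g^-1%g); rewrite -!cone_actM mulVg !cone_act1.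
case: x y => [x|q] [y|q'] /=; rewrite ?actE // => /asboolP H; apply/asboolP.
- exact: cone_act_attach.
- exact: cone_act_attach.
- by case: H => H; [left|right]; exact: cone_act_rung.
Qed.

Lemma cone_edge_sym : symmetric cone_edge.
Proof.
by move=> [x|q] [y|q'] //=; apply/asboolP/asboolP => -[]; auto.
Qed.

Lemma cone_edge_irr : irreflexive cone_edge.
Proof.
move=> [x|q] /=; first exact: irre.
suff nr : ~ rung q q by apply/asboolP => -[].
move=> [g [k [kL qk qk1]]]; have /legP [] : leg g k = leg g k.+1 by rewrite -qk.
- exact: ltnW.
- exact: kL.
by move=> /eqP; rewrite -[k.+1]addn1 -{1}[k]addn0 eqn_add2l.
Qed.

Lemma leg_walk g k : k <= L -> walk cone_edge k.+1 (inl (act g x0)) (inr (leg g k)).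
Proof.
elim: k => [_|k IH kL].
  by apply/walk1; apply/asboolP; exists g.
apply/walkSr; exists (inr (leg g k)); split; first exact/IH/ltnW.
by apply/asboolP; left; exists g, k.
Qed.

Lemma cone_connected : connected_graph cone_edge.
Proof.
have [[x _] cw] := conn_e; split; first by exists (inl x).
have toV a : exists y n, walk cone_edge n (inl y) a.
  case: a => [y|q]; first by exists y, 0; exact/walk0.
  have [g [k [kL ->]]] := leg_surj q; exists (act g x0), k.+1; exact: leg_walk.
move=> a b; have [y [n wa]] := toV a; have [z [m wb]] := toV b.
have [l yz] := cw y z; exists (n + (l + m)).
apply: walk_cat (walk_sym cone_edge_sym wa) _; apply: walk_cat wb.
exact: walk_map yz.
Qed.

Lemma stabilizer_inl x : vertex_stabilizer cone_act (inl x) = vertex_stabilizer act x.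
Proof. by apply/seteqP; split=> g /= => [[]|E]; rewrite /vertex_stabilizer /= ?E. Qed.

Lemma stabilizer_leg1 k : k <= L ->
  vertex_stabilizer cone_act (inr (leg 1%g k)) = leg_group k.
Proof.
move=> kL; have sk : subgroup (leg_group k) by case: (leg_group_open k).
apply/seteqP; split=> g /=; rewrite /vertex_stabilizer /= leg_actE // mulg1.
  move=> [] /legP [] // _ /(subgroupV sk).
  by rewrite invgM invg1 invgK mul1g.
move=> kg; congr inr; apply/legP => //; split=> //.
by rewrite mulg1; exact: subgroupV.
Qed.

Lemma leg_act_cone g k : k <= L -> inr (leg g k) = cone_act g (inr (leg 1%g k)).
Proof. by move=> kL /=; rewrite leg_actE // mulg1. Qed.

Lemma cone_stabilizer_compact q : compact (vertex_stabilizer cone_act (inr q)).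
Proof.
have [g [k [kL ->]]] := leg_surj q; rewrite leg_act_cone //.
apply: (compact_vertex_stabilizer cone_act1 cone_actM).
by rewrite stabilizer_leg1 //; exact: leg_group_compact.
Qed.

Lemma cone_act_open a : open (vertex_stabilizer cone_act a).
Proof.
case: a => [x|q]; first by rewrite stabilizer_inl.
have [g [k [kL ->]]] := leg_surj q; rewrite leg_act_cone //.
apply: (open_vertex_stabilizer cone_act1 cone_actM); rewrite stabilizer_leg1 //.
by case: (leg_group_open k).
Qed.

Lemma cone_cocompact : cocompact_action e act -> cocompact_action cone_edge cone_act.
Proof.
move=> /(finite_of_cocompact act1 actM) [[R fR RP] [E fE EP]].
pose l k : cone_vertex := inr (leg 1%g k).
have lE g k : k <= L -> inr (leg g k) = cone_act g (l k) by exact: leg_act_cone.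
apply: (cocompact_of_finite cone_act1 cone_actM
  (R := (@inl V leg_vertex @` R) `|` (l @` `I_L.+1))
  (E := ((fun p => (inl p.1, inl p.2)) @` E) `|`
    [set (inl x0, l 0); (l 0, inl x0)] `|`
    ((fun k => (l k, l k.+1)) @` `I_L) `|` ((fun k => (l k.+1, l k)) @` `I_L))).
- by rewrite finite_setU; split; apply: finite_image => //; exact: finite_II.
- rewrite !finite_setU; do !split; do 1?[exact: finite_set1];
    by apply: finite_image => //; exact: finite_II.
- move=> [x|q].
    have [g [a [Ra ->]]] := RP x; exists g, (inl a); split=> //.
    by left; exists a.
  have [g [k [kL ->]]] := leg_surj q; exists g, (l k); split; last exact: lE.
  by right; exists k.
have attachE x q : attach x q -> exists g, inl x = cone_act g (inl x0) /\
    inr q = cone_act g (l 0).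
  by move=> [g [-> ->]]; exists g; rewrite lE.
have rungE q q' : rung q q' -> exists g k, [/\ k < L, inr q = cone_act g (l k) &
    inr q' = cone_act g (l k.+1)].
  by move=> [g [k [kL -> ->]]]; exists g, k; rewrite !lE // ltnW.
move=> [x|q] [y|q'] /=.
- move=> /EP [g [a [b [Eab -> ->]]]]; exists g, (inl a), (inl b); split=> //.
  by left; left; left; exists (a, b).
- move=> /asboolP /attachE [g [xE qE]]; exists g, (inl x0), (l 0); split=> //.
  by left; left; right; left.
- move=> /asboolP /attachE [g [xE qE]]; exists g, (l 0), (inl x0); split=> //.
  by left; left; right; right.
- move=> /asboolP [] /rungE [g [k [kL qE q'E]]].
    by exists g, (l k), (l k.+1); split=> //; left; right; exists k.
  by exists g, (l k.+1), (l k); split=> //; right; exists k.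
Qed.

Hypothesis diamC : forall c, C c -> graph_dist e x0 (act c x0) <= L.

Lemma dist_act g x y : graph_dist e (act g x) (act g y) = graph_dist e x y.
Proof.
suff le h a b : graph_dist e (act h a) (act h b) <= graph_dist e a b.
  apply/eqP; rewrite eqn_leq le /=.
  by rewrite -{1}(actK act1 actM g x) -{1}(actK act1 actM g y) le.
apply: dist_le; apply: walk_map (dist_walk conn_e a b) => a' b'.
by rewrite actE.
Qed.

Lemma diam_translate g c : C c -> graph_dist e (act g x0) (act (g * c)%g x0) <= L.
Proof. by move=> Cc; rewrite actM dist_act diamC. Qed.

(** At a leg vertex, either the walk has climbed from that leg's own foot [g x0], or it has been at
    the top, having paid at least [L] for the climb from some foot [g c x0]. Coming down ends within
    [L] of that foot, so legs give no shortcut. *)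
Lemma cone_dist_ge y n z : walk cone_edge n (inl y) z ->
  match z with
  | inl v => is_true (graph_dist e y v <= n)
  | inr q => forall g k, k <= L -> q = leg g k ->
      graph_dist e y (act g x0) + k.+1 <= n \/
      exists2 c, C c & graph_dist e y (act (g * c)%g x0) + L <= n
  end.
Proof.
move: n z; apply: walk_ind_r; first by rewrite dist_xx.
move=> n [v|q] [v'|q'] _ /=.
- move=> IH vv'; apply: leq_trans (dist_tri conn_e v y v') _.
  by rewrite -addn1 leq_add // dist_edge.
- move=> IH /asboolP [h [vE ->]] g k kL /(leg_coset (leq0n L) kL).
  (* When [L = 0] the bottom is already the top, where [leg_coset] does not equate feet; the element
     of [C] records the foot climbed from. *)
  move=> [<- _ Cgh gh]; have [L0|L0] := posnP L.
    by right; exists (g^-1 * h)%g => //; rewrite mulVKg -vE L0; lia.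
  by left; rewrite -gh // -vE; lia.
- move=> IH /asboolP [h [-> qE]]; have [|[c Cc]] := IH _ _ (leq0n L) qE; first lia.
  have := diam_translate h Cc; rewrite (dist_sym conn_e syme).
  have := dist_tri conn_e (act (h * c)%g x0) y (act h x0); lia.
move=> IH /asboolP [] [h [j [jL qE q'E]]] g k kL; rewrite q'E || rewrite qE.
  move=> /(leg_coset jL kL) [kE _ Cgh gh].
  have [jh|[c Cc ch]] := IH _ _ (ltnW jL) qE.
    have [lt_k|ge_k] := ltnP k L.
      by left; rewrite -gh ?kE // -kE; lia.
    by right; exists (g^-1 * h)%g => //; rewrite mulVKg; lia.
  right; exists (g^-1 * h * c)%g; first by apply: subgroupM => //; exact: subgroupC.
  by rewrite !mulgA mulgV mul1g; exact: leqW.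
move=> /(leg_coset (ltnW jL) kL) [kE _ Cgh gh].
have [jh|[c Cc ch]] := IH _ _ jL q'E; first by left; rewrite -gh // -kE; lia.
right; exists (g^-1 * h * c)%g; first by apply: subgroupM => //; exact: subgroupC.
by rewrite !mulgA mulgV mul1g; exact: leqW.
Qed.

Lemma cone_dist x y : graph_dist cone_edge (inl x) (inl y) = graph_dist e x y.
Proof.
apply/eqP; rewrite eqn_leq; apply/andP; split.
  by apply: dist_le; apply: walk_map (dist_walk conn_e x y).
exact: cone_dist_ge (dist_walk cone_connected (inl x) (inl y)).
Qed.

Lemma cone_hyperbolic : gromov_hyperbolic e -> gromov_hyperbolic cone_edge.
Proof.
apply: (hyperbolic_dense (f := inl) (R := L.+1) cone_connected cone_edge_sym cone_dist).
move=> [x|q]; first by exists x; rewrite dist_xx.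
have [g [k [kL ->]]] := leg_surj q; exists (act g x0).
exact: leq_trans (dist_le (leg_walk g kL)) _.
Qed.

(** * Fineness after attaching the legs *)

Section ConingFine.
Hypotheses (lf : locally_fine e) (coco : cocompact_action e act).
Hypothesis edge_compact : forall x y, e x y -> compact (stabilizer act [set x; y]).

Variable P : set V.
Hypothesis finP : finite_set P.
Hypothesis P_hull : forall c c', C c -> C c' -> exists p, [/\ path e (act c x0) p,
  last (act c x0) p = act c' x0, size p <= L & forall z, z \in act c x0 :: p -> P z].

Lemma hull_translate g c : C c -> exists p, [/\ path e (act (g * c)%g x0) p,
  last (act (g * c)%g x0) p = act g x0, size p <= L &
  forall z, z \in act (g * c)%g x0 :: p -> (act g @` P) z].
Proof.
move=> Cc; have [p [cp pl sp Pp]] := P_hull Cc (subgroup1 subgroupC).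
exists (map (act g) p); rewrite actM last_map size_map pl act1; split=> //.
  rewrite path_map; apply: sub_path cp => a b /=.
  by rewrite actE.
by move=> z; rewrite -map_cons => /mapP [y yp ->]; exists y => //; exact: Pp.
Qed.

Section At.
Variable u : V.

(** The turns that a translated hull path can make at [u]; adjacency of [a] and [b] brings in
    compact edge stabilizers. *)
Definition hull_turn (s s' : V) := exists g a b c,
  [/\ P a, P b & P c] /\ [/\ e a b, act g a = s, act g b = u & act g c = s'].

(** For a given entrance [s], the elements carrying a hull edge [(a, b)] to [(s, u)] form a compact
    set, whatever the stabilizer of [u]; so there are finitely many exits. *)
Lemma finite_hull_turn s : finite_set [set s' | hull_turn s s'].
Proof.
apply: (@sub_finite_set _ _ (\bigcup_(a in P) \bigcup_(b in P `&` [set b | e a b])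
    \bigcup_(c in P) [set act g c | g in [set g | act g a = s /\ act g b = u]])).
  move=> s' [g [a [b [c [[Pa Pb Pc] [ab gs gu gs']]]]]].
  by exists a => //; exists b => //; exists c => //; exists g.
apply: bigcup_finite => // a _; apply: bigcup_finite => [|b [_ ab]].
  exact: sub_finite_set finP.
apply: bigcup_finite => // c _; apply: (finite_orbit act1 actM act_open).
by apply: (compact_transporter2 act1 actM act_open); exact: edge_compact.
Qed.

Lemma hull_turnP g s s' : e s u -> e u s' -> (act g @` P) s -> (act g @` P) u ->
  (act g @` P) s' -> hull_turn s s'.
Proof.
move=> su _ [a Pa ga] [b Pb gb] [c Pc gc]; exists g, a, b, c; split=> //.
by split=> //; rewrite -(actE g) ga gb.
Qed.

Variables (St : set V) (Z : set G).
Hypotheses (finSt : finite_set St) (finZ : finite_set [set leg g 0 | g in Z]).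
Hypothesis ZC : forall g c, Z g -> C c -> Z (g * c)%g.
Hypothesis ZSt : forall g, Z g -> act g x0 = u \/ St (act g x0).

Local Notation turn := (turning e u hull_turn St).

(** A condition on the coset [g C] only ([reach_coset]), since a walk over the top may come down any
    leg of the coset. [Z] is the coset of the target when that is a leg vertex, and empty
    otherwise. *)
Definition reach n g := Z g \/ exists2 c, C c & turn n (act (g * c)%g x0).

Lemma reach_coset n g c : C c -> reach n (g * c)%g -> reach n g.
Proof.
move=> Cc [Zgc|[c' Cc' t]].
  left; rewrite -[g](mulgK c); apply: ZC => //; apply: subgroupV Cc; exact: subgroupC.
by right; exists (c * c')%g; [exact: (subgroupM subgroupC) | rewrite mulgA].
Qed.

Lemma reach_le n m g : n <= m -> reach n g -> reach m g.
Proof.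
move=> nm [Zg|[c Cc t]]; first by left.
by right; exists c => //; exact: turning_le nm.
Qed.

Definition cone_reach n (z : cone_vertex) :=
  match z with
  | inl x => turn n x
  | inr q => exists g k, [/\ k <= L, q = leg g k & reach n g]
  end.

Lemma cone_reach_leg n g k : k <= L -> cone_reach n (inr (leg g k)) -> reach n g.
Proof.
move=> kL [h [j [jL /(leg_coset kL jL) [_ Cgh _ _] r]]].
by apply: reach_coset Cgh _; rewrite mulVKg.
Qed.

(** The shadow in the old graph of a walk avoiding [u]: stepping off a leg is replaced by a
    translated hull path of at most [L] edges, which may meet [u], but only by hull turns. *)
Lemma cone_reach_step n z z' : del cone_edge (inl u) z z' -> cone_reach n z ->
  cone_reach (n + L.+1) z'.
Proof.
move=> /and3P [zz' zu z'u]; case: z z' zz' zu z'u => [x|q] [y|q'].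
- rewrite /= => xy _ yu t; apply: (turning_le (n := n.+1)); last lia.
  by apply: turning_step t xy _ => E; rewrite E eqxx in yu.
- move=> /asboolP [h [xE ->]] xu _ t; exists h, 0; split=> //.
  right; exists 1%g; first exact: (subgroup1 subgroupC).
  by rewrite mulg1 -xE; apply: turning_le t _; exact: leq_addr.
- move=> /asboolP [h [yE qE]] _ yu; rewrite qE => /(cone_reach_leg (leq0n L)).
  have hu : act h x0 <> u by move=> E; rewrite yE E eqxx in yu.
  rewrite yE => -[Zh|[c Cc t]]; first by apply: turning0 => //; case: (ZSt Zh).
  have [p [hp pl sp Pp]] := hull_translate h Cc.
  rewrite -pl /=; apply: (turning_le (n := n + size p)); last lia.
  apply: (turning_path (Q := act h @` P)) => //; last by rewrite pl.
  by move=> s s'; exact: hull_turnP.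
move=> /asboolP [] [g [k [kL -> ->]]] _ _.
  move=> /(cone_reach_leg (ltnW kL)) r; exists g, k.+1; split=> //.
  by apply: reach_le r; exact: leq_addr.
move=> /(cone_reach_leg kL) r; exists g, k; split=> //; first exact: ltnW.
by apply: reach_le r; exact: leq_addr.
Qed.

Lemma cone_reach_walk v n z : cone_reach 0 v -> walk (del cone_edge (inl u)) n v z ->
  cone_reach (n * L.+1) z.
Proof.
move=> v0; move: n z; apply: walk_ind_r => // n y z _ ry yz.
by rewrite mulSn addnC; exact: cone_reach_step yz ry.
Qed.

(** Neighbours of [u] are old ones, bottoms of legs in [Z], or bottoms of other legs standing on
    [u = h x0]. In the last case a hull path from a reached foot enters [u] from some [s], and [h]
    carries an edge [(a, x0)] with [a] in [P] to [(s, u)]; compactness applies again. *)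
Lemma finite_cone_reach n : finite_set [set z | cone_edge (inl u) z /\ cone_reach n z].
Proof.
have fT m : finite_set [set s | turn m s /\ e s u].
  apply: finite_turning => // s _; exact: finite_hull_turn.
apply: (@sub_finite_set _ _ ((@inl V leg_vertex @` [set s | turn n s /\ e s u]) `|`
  (@inr V leg_vertex @` [set leg g 0 | g in Z]) `|`
  \bigcup_(s in [set s | turn (n + L) s /\ e s u])
    \bigcup_(a in P `&` [set a | e a x0])
      [set cone_act g (inr (leg 1%g 0)) | g in
         [set g | act g a = s /\ act g x0 = u]])).
  move=> [x|q] /=; first by move=> [ux tx]; left; left; exists x; rewrite // syme.
  move=> [/asboolP [h [uE ->]]] /(cone_reach_leg (leq0n L)) [Zh|[c Cc t]].
    by left; right; exists (leg h 0) => //; exists h.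
  right; have [p [hp pl sp Pp]] := hull_translate h Cc.
  have [|s [ts su [a Pa as_]]] := turning_hit t hp Pp; first by rewrite pl.
  exists s; first by split=> //; apply: turning_le ts _; rewrite leq_add2l.
  exists a; first by split=> //=; rewrite -(actE h) as_ -uE.
  by exists h => //=; rewrite leg_actE // mulg1.
rewrite !finite_setU; split; [split; exact: finite_image|].
apply: bigcup_finite => // s _; apply: bigcup_finite => [|a [_ ax]].
  exact: sub_finite_set finP.
apply: (finite_orbit cone_act1 cone_actM cone_act_open).
by apply: (compact_transporter2 act1 actM act_open); exact: edge_compact.
Qed.

End At.

Lemma cone_locally_fine : locally_fine cone_edge.
Proof.
move=> [u|q] v n uv; last first.
  (* Leg vertices have compact stabilizers, hence finite degree. *)
  apply: (@sub_finite_set _ _ [set z | cone_edge (inr q) z]); first by move=> z [].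
  apply: (finite_degree cone_act1 cone_actM cone_act_open).
    exact: cone_cocompact.
  exact: cone_stabilizer_compact.
(* Walks are read backwards from [v]; [St] and [Z] describe where they start. *)
suff [St [Z [finSt finZ ZC ZSt v0]]] : exists (St : set V) (Z : set G),
    [/\ finite_set St, finite_set [set leg g 0 | g in Z],
      (forall g c, Z g -> C c -> Z (g * c)%g),
      (forall g, Z g -> act g x0 = u \/ St (act g x0)) &
      cone_reach u St Z 0 v].
  apply: (@sub_finite_set _ _ (\bigcup_(m in `I_n.+1)
      [set z | cone_edge (inl u) z /\ cone_reach u St Z (m * L.+1) z])).
    move=> z [uz [m mn w]]; exists m => //; split=> //.
    apply: cone_reach_walk v0 _ => //; apply: walk_sym w.
    by apply: del_sym; exact: cone_edge_sym.
  apply: bigcup_finite => // m _; exact: finite_cone_reach.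
case: v uv => [v|q] uv.
  exists [set v], set0; split=> //; first by rewrite image_set0.
  by apply: turning0 => // E; apply: uv; rewrite E.
have [h [k [kL ->]]] := leg_surj q.
have fZ : compact [set (h * c)%g | c in C] by exact: compact_mulgl.
exists [set act g x0 | g in [set (h * c)%g | c in C]], [set (h * c)%g | c in C]; split.
- exact: (finite_orbit act1 actM act_open).
- pose out (z : cone_vertex) := if z is inr q' then q' else q.
  apply: (@sub_finite_set _ _ (out @` [set cone_act g (inr (leg 1%g 0)) |
    g in [set (h * c)%g | c in C]])).
    move=> _ [g Zg <-]; exists (inr (leg g 0)) => //; exists g => //=.
    by rewrite leg_actE // mulg1.
  apply: finite_image; exact: (finite_orbit cone_act1 cone_actM cone_act_open).
- move=> _ c [d Cd <-] Cc; exists (d * c)%g; last by rewrite mulgA.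
  exact: (subgroupM subgroupC).
- by move=> g Zg; right; exists g.
- exists h, k; split=> //; left; exists 1%g; last by rewrite mulg1.
  exact: (subgroup1 subgroupC).
Qed.

End ConingFine.
End Coning.

Lemma open_of_discrete (G : topologicalGroupType) (V : choiceType) (e : rel V)
    (act : G -> V -> V) x :
  discrete_action e act -> open (vertex_stabilizer act x).
Proof.
move=> /(_ [set x]); rewrite (_ : pointwise_stabilizer _ _ = vertex_stabilizer act x).
  by apply; left; exists x.
by apply/seteqP; split=> [g|g gx _ ->] //; apply.
Qed.

(* Attaching new vertices with stabilizer [C] by legs of length at least the
   diameter of the orbit [C x0] leaves the old graph isometrically embedded. *)
Lemma relatively_hyperbolic_add (G : topologicalGroupType) (HH : set (set G))
    (C : set G) : open_subgroup C -> compact C ->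
  relatively_hyperbolic HH -> relatively_hyperbolic (HH `|` [set C]).
Proof.
move=> oC cC [[tG fHH oHH cHH] [V [e [act [CA /fineP lf he]]]]].
have [[syme irre] ce [act1 actM actE] coco disc cedge cvert cper corb] := CA.
have act_open x : open (vertex_stabilizer act x) by exact: open_of_discrete disc.
have cedge2 x y : e x y -> compact (stabilizer act [set x; y]).
  by move=> xy; apply: cedge; exists x, y.
have [[x0 _] _] := ce.
have [L diamC] := compact_bounded_orbit e x0 act1 actM act_open cC.
have [P finP P_hull] : exists2 P, finite_set P & forall x y,
    [set act c x0 | c in C] x -> [set act c x0 | c in C] y ->
    exists p, [/\ path e x p, last x p = y, size p <= L & forall z, z \in x :: p -> P z].
  apply: finite_hull => //; first exact: (finite_orbit act1 actM act_open).
  move=> _ _ [c Cc <-] [d Cd <-]; have [sC _] := oC.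
  rewrite -[d](mulVKg c); apply: (diam_translate act1 actM actE ce diamC).
  by apply: (subgroupM sC) => //; exact: (subgroupV sC).
pose ee := @cone_edge _ _ e _ _ x0 L act1 actM act_open oC.
pose aa := @cone_act _ _ _ _ x0 L act1 actM act_open oC.
have aa1 : forall x, aa 1%g x = x by exact: cone_act1.
have aaM : forall g h x, aa (g * h)%g x = aa g (aa h x) by exact: cone_actM.
have aa_open : forall x, open (vertex_stabilizer aa x) by exact: cone_act_open.
have ees : symmetric ee by exact: cone_edge_sym.
split.
  split=> //.
  - by rewrite finite_setU; split=> //; exact: finite_set1.
  - by move=> H [/oHH|->].
  - by move=> H K [HH_H|->] // [HH_K|->] //; exact: cHH.
exists (cone_vertex x0 L act1 actM act_open oC), ee, aa; split; last 2 first.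
- apply/fineP; apply: (cone_locally_fine actE cC syme irre lf coco cedge2 finP).
  by move=> c c' Cc Cc'; apply: P_hull; [exists c|exists c'].
- exact: cone_hyperbolic.
split.
- by split=> //; exact: cone_edge_irr.
- exact: cone_connected.
- by split=> //; exact: cone_actE.
- exact: cone_cocompact.
- exact: discrete_of_open.
- have old x y : stabilizer aa [set inl x; inl y] = stabilizer act [set x; y].
    rewrite /stabilizer; apply/seteqP; split=> g /=; rewrite !image_setU !image_set1 /=.
      by move=> /set2_eq [[[->] [->]]|[[->] [->]]] //; rewrite setUC.
    by move=> /set2_eq [[-> ->]|[-> ->]] //; rewrite setUC.
  move=> _ [[x|q] [b [xb ->]]]; last first.
    by apply: (compact_stabilizer2 aa1 aaM aa_open); exact: cone_stabilizer_compact.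
  case: b xb => [y|q] xy; first by rewrite old; exact: cedge2.
  rewrite setUC.
  by apply: (compact_stabilizer2 aa1 aaM aa_open); exact: cone_stabilizer_compact.
- move=> [x|q]; last by left; exact: cone_stabilizer_compact.
  rewrite stabilizer_inl; case: (cvert x) => [|[H HH_H cj]]; [by left|right].
  by exists H => //; left.
- move=> H [/cper [x <-]|->]; first by exists (inl x); rewrite stabilizer_inl.
  exists (inr (leg x0 L act1 actM act_open oC 1%g L)).
  by rewrite stabilizer_leg1 // /leg_group ltnn.
move=> H x y [HH_H|->] ncH; last by [].
case: x => [x|q]; last by move=> E; case: ncH; rewrite -E; exact: cone_stabilizer_compact.
case: y => [y|q]; last by move=> _ E; case: ncH; rewrite -E; exact: cone_stabilizer_compact.
rewrite !stabilizer_inl => xH yH; have [g ->] := corb _ _ _ HH_H ncH xH yH.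
by exists g.
Qed.

(** * HNN extensions and the tree of copies *)

(* The opposite of the symmetric group: [f * g] applies [f] first, so that a
   morphism into it is a right action. *)
Record bijection (S : Type) := Bijection {
  bij_fun :> S -> S;
  bij_inv : S -> S;
  bij_funK : cancel bij_fun bij_inv;
  bij_invK : cancel bij_inv bij_fun
}.

Section BijectionGroup.
Context {S : Type}.
Implicit Types f g h : bijection S.

Lemma bijection_eq f g : f =1 g -> f = g.
Proof.
case: f g => [f f' fK f'K] [g g' gK g'K] /= /funext E; subst g.
suff E : f' = g' by subst g'; congr Bijection; exact: Prop_irrelevance.
by apply/funext => x; rewrite -{1}(g'K x) fK.
Qed.

Definition bij_id : bijection S := @Bijection S id id (fun=> erefl) (fun=> erefl).

Definition bij_mul f g : bijection S :=
  Bijection (can_comp (bij_funK g) (bij_funK f)) (can_comp (bij_invK f) (bij_invK g)).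

Definition bij_opp f : bijection S := Bijection (bij_invK f) (bij_funK f).

Lemma bij_mulA : associative bij_mul.
Proof. by move=> f g h; exact: bijection_eq. Qed.

Lemma bij_mul1 : left_id bij_id bij_mul.
Proof. by move=> f; exact: bijection_eq. Qed.

Lemma bij_mulr1 : right_id bij_id bij_mul.
Proof. by move=> f; exact: bijection_eq. Qed.

Lemma bij_mulV : left_inverse bij_id bij_opp bij_mul.
Proof. by move=> f; apply: bijection_eq => x /=; rewrite bij_invK. Qed.

Lemma bij_mulrV : right_inverse bij_id bij_opp bij_mul.
Proof. by move=> f; apply: bijection_eq => x /=; rewrite bij_funK. Qed.

End BijectionGroup.

HB.instance Definition _ (S : Type) := gen_eqMixin (bijection S).
HB.instance Definition _ (S : Type) := gen_choiceMixin (bijection S).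
HB.instance Definition _ (S : Type) := isGroup.Build (bijection S)
  (@bij_mulA S) (@bij_mul1 S) (@bij_mulr1 S) (@bij_mulV S) (@bij_mulrV S).

Lemma multiplicative_of (G K : magmaType) (f : G -> K) :
  {morph f : x y / (x * y)%g} -> exists F : {multiplicative G -> K}, F =1 f.
Proof.
move=> fM.
pose F : {multiplicative G -> K} := HB.pack f (isMultiplicative.Build G K f fM).
by exists F.
Qed.

Lemma multiplicative1 (G K : groupType) (f : {multiplicative G -> K}) : f 1%g = 1%g.
Proof. by apply: (@mulgI _ (f 1%g)); rewrite -gmulfM !mulg1. Qed.

Lemma multiplicativeV (G K : groupType) (f : {multiplicative G -> K}) x :
  f x^-1%g = (f x)^-1%g.
Proof. by apply: (@mulgI _ (f x)); rewrite -gmulfM !mulgV multiplicative1. Qed.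

Section Shift.
Context {G : groupType} {S : Type}.

Definition shift_fun (g : G) (x : G * S) : G * S := ((x.1 * g)%g, x.2).

Lemma shift_funK g : cancel (shift_fun g) (shift_fun g^-1%g).
Proof. by case=> x s; rewrite /shift_fun /= mulgK. Qed.

Lemma shift_funVK g : cancel (shift_fun g^-1%g) (shift_fun g).
Proof. by case=> x s; rewrite /shift_fun /= mulgVK. Qed.

Definition shift g : bijection (G * S) := Bijection (shift_funK g) (shift_funVK g).

Lemma shiftM : {morph shift : g h / (g * h)%g}.
Proof. by move=> g h; apply: bijection_eq => -[x s]; rewrite /= /shift_fun /= mulgA. Qed.

End Shift.

Section HNN.
Context {A G : topologicalGroupType} {C : set A} {alpha : A -> A}
  {i : {multiplicative A -> G}} {t : G}.
Hypothesis G_hnn : hnn_extension C alpha i t.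

Lemma hnn_commute c : C c -> (i c * t = t * i (alpha c))%g.
Proof.
by move=> Cc; rewrite -(hnn_relation G_hnn Cc) -mulgA mulVKg.
Qed.

(* By uniqueness in the universal property, the shift action of [G] on
   [G * bool] commutes with the twist by [P], as [A] and [t] do. *)
Lemma hnn_ind (P : G -> Prop) : P 1%g -> (forall g a, P g -> P (g * i a)%g) ->
  (forall g, P g <-> P (g * t)%g) -> forall g, P g.
Proof.
move=> P1 PA Pt g; pose b x := `[< P x >].
have bA x a : b (x * i a)%g = b x.
  apply/asboolP/asboolP => [H|]; last exact: PA.
  by rewrite -(mulgK (i a) x) -multiplicativeV; exact: PA.
have bt x : b (x * t)%g = b x by rewrite /b; congr asbool; apply/propext; exact: iff_sym (Pt x).
pose tw (x : G * bool) := (x.1, x.2 (+) b x.1).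
have twK : involutive tw by case=> x s; rewrite /tw /= addbK.
pose T : bijection (G * bool) := Bijection twK twK.
have [f fE] : exists F : {multiplicative A -> bijection (G * bool)},
    F =1 fun a => shift (i a).
  by apply: multiplicative_of => a a'; rewrite gmulfM shiftM.
have [phi1 phi1E] := multiplicative_of (@shiftM G bool).
have [phi2 phi2E] : exists F : {multiplicative G -> bijection (G * bool)},
    F =1 fun g => (T * shift g * T)%g.
  apply: multiplicative_of => x y; apply: bijection_eq => z /=.
  by rewrite twK /shift_fun /tw /= mulgA.
have [|phi [_ _ uni]] := hnn_universal G_hnn (f := f) (s := shift t).
  move=> c Cc; rewrite !fE -mulgA; apply: (canLR (mulKg _)).
  by rewrite -!shiftM hnn_commute.
have /(_ g) E1 : phi1 =1 phi by apply: uni => [a|]; rewrite phi1E ?fE.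
have /(_ g) E2 : phi2 =1 phi.
  apply: uni => [a|]; rewrite phi2E ?fE; apply: bijection_eq => -[x s] /=;
  by rewrite /shift_fun /tw /= ?bA ?bt -addbA addbb addbF.
(* At [(1, false)] the twisted shift has second coordinate [b 1 (+) b g], with [b 1] true; equality
   with [false] gives [P g]. *)
have := congr1 (fun k : bijection (G * bool) => k (1%g, false)) (etrans E1 (esym E2)).
rewrite phi1E phi2E /= /shift_fun /tw /= mul1g /b (asboolT P1) => -[].
by move=> /esym/negbFE/asboolP.
Qed.

(* [G] acts on [G * S] on the right, [t] acting by [tau] on the second factor. *)
Lemma hnn_transport (S : Type) (tau : G -> S -> S) (s0 : S) :
  (forall g, involutive (tau g)) ->
  (forall g c, C c -> tau (g * i c)%g =1 tau g) ->
  exists r : G -> S, [/\ r 1%g = s0, forall g a, r (g * i a)%g = r g &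
    forall g, r (g * t)%g = tau g (r g)].
Proof.
move=> tauK tauC.
pose T (x : G * S) := ((x.1 * t)%g, tau x.1 x.2).
pose T' (x : G * S) := ((x.1 * t^-1)%g, tau (x.1 * t^-1)%g x.2).
have TK : cancel T T' by case=> x s; rewrite /T /T' /= mulgK tauK.
have T'K : cancel T' T by case=> x s; rewrite /T /T' /= mulgVK tauK.
pose BT : bijection (G * S) := Bijection TK T'K.
have [f fE] : exists F : {multiplicative A -> bijection (G * S)},
    F =1 fun a => shift (i a).
  by apply: multiplicative_of => a a'; rewrite gmulfM shiftM.
have [|phi [phiA phit _]] := hnn_universal G_hnn (f := f) (s := BT).
  (* The defining relation holds for these bijections because [tau] is constant on cosets of
     [i C]. *)
  move=> c Cc; rewrite -mulgA; apply: (canLR (mulKg _)); apply: bijection_eq => -[x s].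
  by rewrite !fE /= /T /shift_fun /= tauC // -!mulgA hnn_commute.
have phi1 g : forall x, (phi g x).1 = (x.1 * g)%g.
  elim/hnn_ind: g => [x|g a IH x|g].
  - by rewrite multiplicative1 /= mulg1.
  - by rewrite gmulfM /= phiA fE /= IH mulgA.
  split=> IH x; first by rewrite gmulfM /= phit /= IH mulgA.
  have := IH x; rewrite gmulfM /= phit /= mulgA; exact: mulIg.
exists (fun g => (phi g (1%g, s0)).2); split=> [|g a|g].
- by rewrite multiplicative1.
- by rewrite gmulfM /= phiA fE.
by rewrite gmulfM /= phit /= phi1 mul1g.
Qed.

(** * Directions at a vertex of the Bass-Serre tree *)

Section Sides.
Context {V : choiceType} {act : A -> V -> V} {p q : V}.
Hypothesis act1 : forall x, act 1%g x = x.
Hypothesis actM : forall a b x, act (a * b)%g x = act a (act b x).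
Hypothesis stab_p : vertex_stabilizer act p = C.
Hypothesis stab_q : vertex_stabilizer act q = alpha @` C.

(** The value [1] off the range of [i] is arbitrary. *)
Definition base (g : G) : A :=
  if pselect (exists a, g = i a) is left H then projT1 (cid H) else 1%g.

Lemma base_i a : base (i a) = a.
Proof.
rewrite /base; case: pselect => [H|[]]; last by exists a.
by case: cid => b /= /(hnn_injective G_hnn).
Qed.

(* The edge of the Bass-Serre tree at the vertex [A] that a step from [g A] to
   [g t A] crosses, if any; [(true, act a p)] stands for the edge from [A] to
   [a t A] and [(false, act a q)] for the edge from [a t^-1 A] to [A]. *)
Definition crossed (g : G) : option (bool * V) :=
  if `[< exists a, g = i a >] then Some (true, act (base g) p) else
  if `[< exists a, (g * t)%g = i a >] then Some (false, act (base (g * t)%g) q)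
  else None.

(** The transposition of [None] and [l]: crossing the edge [l] exchanges being at [A] with being
    beyond [l]. For [l = None], an edge not at [A], it is the identity. *)
Definition swap_none (l s : option (bool * V)) :=
  if s == None then l else if s == l then None else s.

Lemma swap_noneK l : involutive (swap_none l).
Proof.
move=> s; rewrite /swap_none; have [->|sN] := eqVneq s None.
  by rewrite eqxx; case: eqP.
case: (eqVneq s l) => [->|sl]; first by rewrite eqxx.
by rewrite (negPf sN) (negPf sl).
Qed.

Lemma p_fixed a c : C c -> act (a * c)%g p = act a p.
Proof. by rewrite -stab_p actM => ->. Qed.

Lemma q_fixed a c : C c -> act (a * alpha c)%g q = act a q.
Proof.
move=> Cc; rewrite actM; congr act.
suff : vertex_stabilizer act q (alpha c) by [].
by rewrite stab_q; exists c.
Qed.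

Lemma image_mulr g a : (exists b, (g * i a)%g = i b) <-> exists b, g = i b.
Proof.
split=> [] [b E]; last by exists (b * a)%g; rewrite E gmulfM.
by exists (b / a)%g; rewrite gmulfM multiplicativeV -E mulgK.
Qed.

(** Edges of the Bass-Serre tree are cosets of [C]; this is the compatibility that [hnn_transport]
    asks of [tau]. *)
Lemma crossed_C g c : C c -> crossed (g * i c)%g = crossed g.
Proof.
move=> Cc; rewrite /crossed -mulgA hnn_commute // mulgA.
rewrite (propext (image_mulr g c)) (propext (image_mulr (g * t)%g (alpha c))).
case: asboolP => [[a ->]|_]; first by rewrite -gmulfM !base_i p_fixed.
by case: asboolP => [[a ->]|_] //; rewrite -gmulfM !base_i q_fixed.
Qed.

Lemma side_exists : exists r : G -> option (bool * V),
  [/\ r 1%g = None, forall g a, r (g * i a)%g = r g &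
    forall g, r (g * t)%g = swap_none (crossed g) (r g)].
Proof.
apply: (hnn_transport (tau := fun g => swap_none (crossed g))) => [g|g c Cc s].
  exact: swap_noneK.
by rewrite crossed_C.
Qed.

(* [side g] is the edge at [A] on the way to [g A], and [None] if [g A = A]. *)
Definition side : G -> option (bool * V) := projT1 (cid side_exists).

Lemma side1 : side 1%g = None.
Proof. by rewrite /side; case: cid => r /= []. Qed.

Lemma side_mulr g a : side (g * i a)%g = side g.
Proof. by rewrite /side; case: cid => r /= []. Qed.

Lemma side_t g : side (g * t)%g = swap_none (crossed g) (side g).
Proof. by rewrite /side; case: cid => r /= []. Qed.

Lemma side_i a : side (i a) = None.
Proof. by rewrite -[i a]mul1g side_mulr side1. Qed.

Lemma crossed_i a : crossed (i a) = Some (true, act a p).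
Proof. by rewrite /crossed asboolT ?base_i //; exists a. Qed.

Lemma side_it a : side (i a * t)%g = Some (true, act a p).
Proof. by rewrite side_t side_i crossed_i. Qed.

(** Stands in for Britton's lemma. Induction along [t]: if [g] or [g t] lies in [A], the edge
    crossed is at [A] and [swap_none] decides; otherwise the direction does not change. *)
Lemma sideP g : side g = None <-> exists a, g = i a.
Proof.
split=> [|[a ->]]; last exact: side_i.
move: g; apply: hnn_ind => [_|g a IH|g]; first by exists 1%g; rewrite multiplicative1.
  by rewrite side_mulr => /IH H; exact/image_mulr.
rewrite side_t /crossed; case: asboolP => [[a ->]|nA].
  by rewrite side_i /swap_none /=; split=> // _ _; exists a.
case: asboolP => [[a gt]|nAt]; first rewrite gt base_i.
  split=> [_ _|_ gN]; first by exists a.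
  have := side_i a; rewrite -gt side_t /crossed (asboolF nA) asboolT; last by exists a.
  by rewrite gN.
rewrite /swap_none; case: (side g) => [l|] /=; first by split.
by split=> H _; [case: nA|case: nAt]; exact: H.
Qed.

Lemma side_into g a : (g * t)%g = i a -> side g = Some (false, act a q).
Proof.
move=> gt; have nA : ~ exists b, g = i b.
  by move=> [b E]; have := side_it b; rewrite -E gt side_i.
have := side_i a; rewrite -gt side_t /crossed (asboolF nA) asboolT; last by exists a.
rewrite gt base_i /swap_none; case: eqP => [/sideP //|gN].
by case: eqP => // _ /gN.
Qed.

Lemma side_out g : ~ (exists a, g = i a) -> ~ (exists a, (g * t)%g = i a) ->
  side (g * t)%g = side g.
Proof.
move=> nA nAt; rewrite side_t /crossed !asboolF // /swap_none.
by case: eqP => // /eqP /negPf ->.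
Qed.

Definition label_act (a : A) (l : bool * V) := (l.1, act a l.2).

(** [A] fixes its own vertex of the tree and permutes the edges there. The induction runs over right
    multiplications, by which [side] is characterized. *)
Lemma side_mull a g : side (i a * g)%g = omap (label_act a) (side g).
Proof.
move: g a; apply: hnn_ind => [a|g b IH a|g].
- by rewrite mulg1 side_i side1.
- by rewrite mulgA !side_mulr IH.
have step a : crossed (i a * g)%g = omap (label_act a) (crossed g).
  have AE h : (exists b, (i a * h)%g = i b) <-> exists b, h = i b.
    split=> [] [b E]; last by exists (a * b)%g; rewrite E gmulfM.
    by exists (a^-1 * b)%g; rewrite gmulfM multiplicativeV -E mulKg.
  rewrite /crossed -mulgA (propext (AE g)) (propext (AE (g * t)%g)).
  case: asboolP => [[b ->]|_]; first by rewrite -gmulfM !base_i actM.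
  by case: asboolP => [[b ->]|_] //; rewrite -gmulfM !base_i actM.
have inj a : injective (omap (label_act a)).
  case=> [[b x]|] [[b' x']|] //= [-> /(congr1 (act a^-1%g))].
  by rewrite -!actM mulVg !act1 => ->.
have swapE a l s : swap_none (omap (label_act a) l) (omap (label_act a) s) =
    omap (label_act a) (swap_none l s).
  rewrite /swap_none (inj_eq (inj a)) -[None in LHS](_ : omap (label_act a) None = None) //.
  by rewrite (inj_eq (inj a)); case: ifP => //; case: ifP.
split=> IH a; first by rewrite mulgA !side_t step IH swapE.
have := IH a; rewrite mulgA !side_t step -swapE.
move=> /(congr1 (swap_none (omap (label_act a) (crossed g)))).
by rewrite !swap_noneK.
Qed.

Lemma side_label g l : side g = Some l ->
  exists a, l = (true, act a p) \/ l = (false, act a q).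
Proof.
move: g l; apply: hnn_ind => [l|g a IH l|g]; first by rewrite side1.
  by rewrite side_mulr; exact: IH.
have cr l : crossed g = Some l -> exists a, l = (true, act a p) \/ l = (false, act a q).
  rewrite /crossed; case: asboolP => [[a ->] [<-]|_].
    by exists (base (i a)); left.
  by case: asboolP => [[a ->] [<-]|] //; exists (base (i a)); right.
split=> IH l; last first.
  rewrite -(swap_noneK (crossed g) (side g)) -side_t.
  rewrite /swap_none; case: eqP => [_ /cr //|_]; case: eqP => // _; exact: IH.
rewrite side_t /swap_none; case: eqP => [_ /cr //|_]; case: eqP => // _; exact: IH.
Qed.

(** * The tree of copies and its retraction *)

Definition tree_eq (x y : G * V) : bool :=
  `[< exists a, y.1 = (x.1 * i a)%g /\ x.2 = act a y.2 >].

Lemma tree_eq_refl : reflexive tree_eq.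
Proof.
by move=> x; apply/asboolP; exists 1%g; rewrite multiplicative1 mulg1 act1.
Qed.

Lemma tree_eq_sym : symmetric tree_eq.
Proof.
suff imp x y : tree_eq x y -> tree_eq y x by move=> x y; apply/idP/idP; exact: imp.
move=> /asboolP [a [ya xa]]; apply/asboolP; exists a^-1%g.
by rewrite ya xa multiplicativeV mulgK -actM mulVg act1.
Qed.

Lemma tree_eq_trans : transitive tree_eq.
Proof.
move=> y x z /asboolP [a [ya xa]] /asboolP [b [zb yb]]; apply/asboolP.
by exists (a * b)%g; rewrite zb ya xa yb gmulfM mulgA actM.
Qed.

Canonical tree_equiv := EquivRel tree_eq tree_eq_refl tree_eq_sym tree_eq_trans.

(* [G x_A V]: one copy of the graph for each coset of [A]. *)
Definition tree_vertex := {eq_quot tree_equiv}.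
HB.instance Definition _ := Choice.on tree_vertex.

Definition mk (g : G) (x : V) : tree_vertex := \pi_tree_vertex (g, x).
Arguments mk g%_group_scope x.

Lemma mkP g x h y : mk g x = mk h y <-> exists a, h = (g * i a)%g /\ x = act a y.
Proof.
split=> [/eqmodP /asboolP //|H].
by apply/eqmodP; exact/asboolP.
Qed.

Lemma mk_surj u : exists g x, u = mk g x.
Proof. by rewrite -[u]reprK; case: (repr u) => g x; exists g, x. Qed.

Lemma mk_mulr g a x : mk (g * i a) x = mk g (act a x).
Proof.
by symmetry; apply/mkP; exists a.
Qed.

Lemma mk_i a x : mk (i a) x = mk 1 (act a x).
Proof. by rewrite -mk_mulr mul1g. Qed.

Lemma mk_inj g : injective (mk g).
Proof.
move=> x y /mkP [a [/esym ga ->]].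
suff -> : a = 1%g by rewrite act1.
apply: (hnn_injective G_hnn); rewrite multiplicative1.
by apply: (@mulgI _ g); rewrite ga mulg1.
Qed.

Definition tree_act (g : G) (u : tree_vertex) := mk (g * (repr u).1) (repr u).2.

Lemma tree_actE g h x : tree_act g (mk h x) = mk (g * h) x.
Proof.
rewrite /tree_act; set u := repr _.
have /mkP [a [-> ->]] : mk u.1 u.2 = mk h x by rewrite -[RHS]reprK -/u; case: (u).
by rewrite mulgA mk_mulr.
Qed.

Lemma tree_act1 u : tree_act 1%g u = u.
Proof. by have [g [x ->]] := mk_surj u; rewrite tree_actE mul1g. Qed.

Lemma tree_actM g h u : tree_act (g * h)%g u = tree_act g (tree_act h u).
Proof. by have [k [x ->]] := mk_surj u; rewrite !tree_actE mulgA. Qed.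

Lemma mk_tree_act g x : mk g x = tree_act g (mk 1 x).
Proof. by rewrite tree_actE mulg1. Qed.

Lemma stabilizer_mk1 x : vertex_stabilizer tree_act (mk 1 x) =
  i @` vertex_stabilizer act x.
Proof.
apply/seteqP; split=> [g|_ [a ax <-]]; rewrite /vertex_stabilizer /= tree_actE mulg1.
  move=> /mkP [a [/esym ga xa]]; exists a^-1%g.
    by rewrite /vertex_stabilizer /= {1}xa -actM mulVg act1.
  by rewrite multiplicativeV -[g](mulgK (i a)) ga mul1g.
by rewrite mk_i ax.
Qed.

Lemma tree_stabilizer_compact g x : compact (vertex_stabilizer act x) ->
  compact (vertex_stabilizer tree_act (mk g x)).
Proof.
move=> cx; rewrite mk_tree_act; apply: (compact_vertex_stabilizer tree_act1 tree_actM).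
rewrite stabilizer_mk1; apply: compact_image_continuous cx.
exact: (hnn_continuous G_hnn).
Qed.

Lemma tree_act_open u : (forall x, open (vertex_stabilizer act x)) ->
  open (vertex_stabilizer tree_act u).
Proof.
move=> act_open; have [g [x ->]] := mk_surj u.
rewrite mk_tree_act; apply: (open_vertex_stabilizer tree_act1 tree_actM).
by rewrite stabilizer_mk1; exact: (hnn_open G_hnn).
Qed.

Definition zone (u : tree_vertex) := side (repr u).1.

Lemma zone_mk g x : zone (mk g x) = side g.
Proof.
rewrite /zone; set u := repr _.
have /mkP [a [-> _]] : mk u.1 u.2 = mk g x by rewrite -[RHS]reprK -/u; case: (u).
by rewrite side_mulr.
Qed.

(* The copies other than the one at [A] collapse to the end, in that copy, of
   the edge leading to them. *)
Definition retr (u : tree_vertex) : V :=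
  if side (repr u).1 is Some l then l.2 else act (base (repr u).1) (repr u).2.

Lemma retr_mk g x : retr (mk g x) =
  if side g is Some l then l.2 else act (base g) x.
Proof.
rewrite /retr; set u := repr _.
have /mkP [a [-> ->]] : mk u.1 u.2 = mk g x by rewrite -[RHS]reprK -/u; case: (u).
rewrite side_mulr; case E: (side _) => [//|]; move/sideP: E => [b ->].
by rewrite -gmulfM !base_i actM.
Qed.

Lemma retr_mk1 x : retr (mk 1 x) = x.
Proof. by rewrite retr_mk side1 -(multiplicative1 i) base_i act1. Qed.

Definition bridge (u v : tree_vertex) := exists g, u = mk g p /\ v = mk (g * t) q.

(** Only bridges touching the copy at [A] change the zone. The retraction is constant even along
    these, since a zone collapses to the end of the bridge leading into it. *)
Lemma bridge_cases u v : bridge u v ->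
  [\/ exists a, [/\ u = mk 1 (act a p), v = mk (i a * t) q, zone u = None,
          zone v = Some (true, act a p) & retr u = retr v],
      exists a, [/\ u = mk (i a * t^-1) p, v = mk 1 (act a q), zone v = None,
          zone u = Some (false, act a q) & retr u = retr v] |
      zone u = zone v /\ retr u = retr v].
Proof.
move=> [g [-> ->]]; rewrite !zone_mk !retr_mk.
have [[a ->]|nA] := pselect (exists a, g = i a).
  by apply: Or31; exists a; rewrite mk_i side_i side_it base_i.
have [[a gt]|nAt] := pselect (exists a, (g * t)%g = i a).
  apply: Or32; exists a; rewrite (side_into gt) gt mk_i side_i base_i; split=> //.
  by rewrite -gt mulgK.
apply: Or33; rewrite side_out //; case E: (side g) => [//|].
by move/sideP: E.
Qed.

Lemma bridge_act g u v : bridge u v -> bridge (tree_act g u) (tree_act g v).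
Proof. by move=> [h [-> ->]]; exists (g * h)%g; rewrite !tree_actE mulgA. Qed.

Section TreeGraph.
Variable e : rel V.
Hypothesis actE : forall a x y, e (act a x) (act a y) = e x y.

Definition inside (u v : tree_vertex) :=
  exists g x y, [/\ e x y, u = mk g x & v = mk g y].

Definition tree_edge : rel tree_vertex :=
  fun u v => `[< [\/ inside u v, bridge u v | bridge v u] >].

Lemma tree_edge_mk g x y : e x y -> tree_edge (mk g x) (mk g y).
Proof. by move=> xy; apply/asboolP/Or31; exists g, x, y. Qed.

Lemma tree_edge_bridge g : tree_edge (mk g p) (mk (g * t) q).
Proof. by apply/asboolP/Or32; exists g. Qed.

Lemma tree_actEdge g u v : tree_edge (tree_act g u) (tree_act g v) = tree_edge u v.
Proof.
suff imp h a b : tree_edge a b -> tree_edge (tree_act h a) (tree_act h b).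
  apply/idP/idP; last exact: imp.
  by move=> /(imp g^-1%g); rewrite -!tree_actM mulVg !tree_act1.
move=> /asboolP H; apply/asboolP; case: H => [[k [x [y [xy -> ->]]]]|H|H].
- by apply: Or31; exists (h * k)%g, x, y; rewrite !tree_actE.
- by apply/Or32/bridge_act.
- by apply/Or33/bridge_act.
Qed.

Hypotheses (syme : symmetric e) (irre : irreflexive e).

Lemma tree_edge_sym : symmetric tree_edge.
Proof.
move=> u v; apply/asboolP/asboolP => -[[g [x [y [xy -> ->]]]]|H|H];
  try (by apply: Or33); try (by apply: Or32);
  by apply: Or31; exists g, y, x; rewrite syme.
Qed.

Lemma bridge_neq u : ~ bridge u u.
Proof.
move=> [g [-> /mkP [a [/mulgI ta _]]]].
by have := side_it 1%g; rewrite multiplicative1 mul1g ta side_i.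
Qed.

Lemma tree_edge_irr : irreflexive tree_edge.
Proof.
move=> u; apply/negP => /asboolP [[g [x [y [xy -> /mk_inj E]]]]|/bridge_neq|/bridge_neq] //.
by rewrite E irre in xy.
Qed.

(** Makes the retraction 1-Lipschitz, whence copies are isometrically embedded, and lets it carry
    walks to walks in the base copy. *)
Lemma retr_edge u v : tree_edge u v ->
  (exists x y, [/\ e x y, u = mk 1 x & v = mk 1 y]) \/ retr u = retr v.
Proof.
move=> /asboolP [[g [x [y [xy -> ->]]]]|/bridge_cases|/bridge_cases].
- rewrite !retr_mk; case E: (side g) => [l|]; [by right|left].
  move/sideP: E => [a ->]; exists (act a x), (act a y).
  by rewrite !mk_i actE.
- by move=> [[a [_ _ _ _ ->]]|[a [_ _ _ _ ->]]|[_ ->]]; right.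
- by move=> [[a [_ _ _ _ ->]]|[a [_ _ _ _ ->]]|[_ ->]]; right.
Qed.

(** The label [(true, a p)] determines [a C], as the stabilizer of [p] is exactly [C]; moving [c]
    past [t] turns it into [alpha c], which fixes [q], so the far end is determined too. The label
    [(false, a q)] is symmetric. *)
Lemma zone_cuts l : cuts (e := tree_edge) (fun u => zone u == Some l).
Proof.
have cross u v : tree_edge u v -> zone u == Some l -> zone v != Some l ->
    (exists a, [/\ l = (true, act a p), v = mk 1 (act a p) & u = mk (i a * t) q]) \/
    (exists a, [/\ l = (false, act a q), v = mk 1 (act a q) & u = mk (i a * t^-1) p]).
  move=> /asboolP [[g [x [y [xy -> ->]]]]|/bridge_cases|/bridge_cases].
  - by rewrite !zone_mk => ->.
  - move=> [[a [-> -> -> _ _]]|[a [-> -> _ -> _]]|[-> _]] //.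
      by move=> /eqP [<-] _; right; exists a.
    by move=> ->.
  - move=> [[a [-> -> _ -> _]]|[a [-> -> -> _ _]]|[-> _]] //.
      by move=> /eqP [<-] _; left; exists a.
    by move=> ->.
move=> u v u' v' uv uv' hu hv hu' hv'.
have trans x a b : act a x = act b x -> exists2 c, vertex_stabilizer act x c & b = (a * c)%g.
  move=> E; exists (a^-1 * b)%g; last by rewrite mulVKg.
  by rewrite /vertex_stabilizer /= actM -E -actM mulVg act1.
have [[a [la -> ->]]|[a [la -> ->]]] := cross _ _ uv hu hv;
  have [[b [lb -> ->]]|[b [lb -> ->]]] := cross _ _ uv' hu' hv';
  move: lb; rewrite la => -[] // E; rewrite E; split=> //.
  have [c] := trans _ _ _ E; rewrite stab_p => Cc ->.
  rewrite gmulfM -mulgA (hnn_commute Cc) mulgA mk_mulr; congr mk.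
  by rewrite -[alpha c]mul1g q_fixed // act1.
have [c] := trans _ _ _ E; rewrite stab_q => -[d Cd <-] ->.
rewrite gmulfM -mulgA.
have -> : (i (alpha d) * t^-1 = t^-1 * i d)%g.
  by rewrite -(hnn_relation G_hnn Cd) -!mulgA mulgV mulg1.
rewrite mulgA mk_mulr; congr mk.
by symmetry; suff : vertex_stabilizer act p d by []; rewrite stab_p.
Qed.

Definition same_copy (u v : tree_vertex) :=
  exists g x y, u = mk g x /\ v = mk g y.

Lemma zone_separates u v : ~ same_copy u v ->
  exists2 h, cuts (e := tree_edge) h & h u != h v.
Proof.
have [g [x ->]] := mk_surj u; have [k [y ->]] := mk_surj v => nB.
case E: (side (g^-1 * k)%g) => [l|]; last first.
  case: nB; move/sideP: E => [a E]; exists g, x, (act a y); split=> //.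
  by rewrite -mk_mulr -E mulVKg.
(* The half space towards the copy [k A] as seen from [g A], which is first translated to [A]. *)
exists (fun z => zone (tree_act g^-1%g z) == Some l).
  move=> z z' w w' zz' ww' hz hz' hw hw'.
  have [] := zone_cuts (l := l) _ _ hz hz' hw hw'; rewrite ?tree_actEdge //.
  by do 2 move=> /(can_inj (actKV tree_act1 tree_actM g)) ->.
by rewrite !tree_actE !zone_mk mulVg side1 E eqxx.
Qed.

Hypothesis ce : connected_graph e.

Lemma tree_connected : connected_graph tree_edge.
Proof.
have [[x0 _] cw] := ce; split; first by exists (mk 1 x0).
have within g x y : exists n, walk tree_edge n (mk g x) (mk g y).
  have [n w] := cw x y; exists n; apply: walk_map w => a b; exact: tree_edge_mk.
suff from1 g x : exists n, walk tree_edge n (mk 1 x0) (mk g x).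
  move=> u v; have [g [x ->]] := mk_surj u; have [k [y ->]] := mk_surj v.
  have [n wn] := from1 g x; have [m wm] := from1 k y; exists (n + m).
  exact: walk_cat (walk_sym tree_edge_sym wn) wm.
move: g x; apply: hnn_ind => [x|g a IH x|g]; first exact: within.
  by rewrite mk_mulr; exact: IH.
have /walk1 br := tree_edge_bridge g.
split=> IH x.
  have [n wn] := IH p; have [m wm] := within (g * t)%g q x.
  by exists (n + (1 + m)); apply: walk_cat wn _; exact: walk_cat br wm.
have [n wn] := IH q; have [m wm] := within g p x.
exists (n + (1 + m)); apply: walk_cat wn _; apply: walk_cat wm.
by apply/walk1; rewrite tree_edge_sym; exact/walk1.
Qed.

Lemma tree_dist_act g u v :
  graph_dist tree_edge (tree_act g u) (tree_act g v) = graph_dist tree_edge u v.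
Proof. exact: dist_act tree_act1 tree_actM tree_actEdge tree_connected _ _ _. Qed.

Lemma tree_dist g x y : graph_dist tree_edge (mk g x) (mk g y) = graph_dist e x y.
Proof.
rewrite !(mk_tree_act g) tree_dist_act; apply/eqP; rewrite eqn_leq; apply/andP; split.
  apply: dist_le; apply: walk_map (dist_walk ce x y) => a b; exact: tree_edge_mk.
suff lip n u : walk tree_edge n (mk 1 x) u -> graph_dist e x (retr u) <= n.
  by rewrite -{1}(retr_mk1 y); apply: lip; exact: (dist_walk tree_connected).
move: n u; apply: walk_ind_r => [|n u v _ IH]; first by rewrite retr_mk1 dist_xx.
move=> /retr_edge [[a [b [ab uE vE]]]|<-]; last exact: leqW.
rewrite uE retr_mk1 in IH; rewrite vE retr_mk1.
apply: leq_trans (dist_tri ce a x b) _.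
by rewrite -addn1 leq_add // dist_edge.
Qed.

Lemma tree_hyperbolic : gromov_hyperbolic e -> gromov_hyperbolic tree_edge.
Proof.
move=> /hyperbolicP [c cP].
apply: (hyperbolic_cuts tree_connected tree_edge_sym zone_separates); exists c.
move=> _ x y z [g [w' [x' [-> ->]]]] By Bz.
have inB v : same_copy (mk g w') v -> exists v', v = mk g v'.
  move=> [k [a [b [/mkP [s [-> _]] ->]]]].
  by exists (act s b); rewrite mk_mulr.
have [y' ->] := inB _ By; have [z' ->] := inB _ Bz.
rewrite /four_point !tree_dist; exact: cP.
Qed.

Hypothesis act_open : forall x, open (vertex_stabilizer act x).
Hypothesis compactC : compact C.

Lemma stab_p_compact : compact (vertex_stabilizer act p).
Proof. by rewrite stab_p. Qed.

Lemma stab_q_compact : compact (vertex_stabilizer act q).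
Proof.
rewrite stab_q; have [_ _ ac _] := hnn_iso G_hnn.
exact: continuous_compact ac compactC.
Qed.

(* A walk avoiding [x] in the copy at [A] retracts to a walk avoiding [x]: the
   retraction only moves along edges of that copy. *)
Lemma retr_avoid x y n v : y <> x -> walk (del tree_edge (mk 1 x)) n (mk 1 y) v ->
  retr v <> x /\ exists2 m, m <= n & walk (del e x) m y (retr v).
Proof.
move=> yx; move: n v; apply: walk_ind_r.
  by rewrite retr_mk1; split=> //; exists 0 => //; exact/walk0.
move=> n u v _ [ux [m mn w]] /and3P [/retr_edge uv _ vx]; case: uv => [|<-]; last first.
  by split=> //; exists m => //; exact: leqW.
move=> [a [b [ab uE vE]]]; rewrite vE retr_mk1; rewrite uE retr_mk1 in ux w.
have bx : b <> x by move=> E; rewrite vE E eqxx in vx.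
split=> //; exists m.+1 => //; apply/walkSr; exists a; split=> //.
by apply/and3P; split=> //; exact/eqP.
Qed.

Lemma tree_locally_fine : locally_fine e -> locally_fine tree_edge.
Proof.
move=> lf.
suff at1 x v n : mk 1 x <> v -> finite_set [set z | tree_edge (mk 1 x) z /\
    exists2 m, m <= n & walk (del tree_edge (mk 1 x)) m z v].
  move=> u v n uv; have [g [x uE]] := mk_surj u.
  apply: (@sub_finite_set _ _ (tree_act g @` [set z | tree_edge (mk 1 x) z /\
      exists2 m, m <= n & walk (del tree_edge (mk 1 x)) m z (tree_act g^-1%g v)])).
    move=> z [uz [m mn w]]; exists (tree_act g^-1%g z).
      rewrite uE mk_tree_act in uz w.
      split; first by rewrite -(tree_actEdge g) (actKV tree_act1 tree_actM).
      exists m => //; apply: walk_map w => a b /and3P [ab au bu].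
      have can := actKV tree_act1 tree_actM g.
      apply/and3P; split; first by rewrite tree_actEdge.
        by apply: contraNneq au => <-; rewrite can.
      by apply: contraNneq bu => <-; rewrite can.
    exact: (actKV tree_act1 tree_actM).
  apply: finite_image; apply: at1 => E; apply: uv.
  by rewrite uE mk_tree_act E (actKV tree_act1 tree_actM).
have to w w' : compact (vertex_stabilizer tree_act w) ->
    finite_set [set tree_act g w' | g in [set g | tree_act g w = mk 1 x]].
  move=> cw; apply: (finite_orbit tree_act1 tree_actM).
    by move=> ?; exact: tree_act_open.
  exact: (compact_transporter tree_act1 tree_actM).
move=> xv; apply: (@sub_finite_set _ _
  ([set tree_act g (mk t q) | g in [set g | tree_act g (mk 1 p) = mk 1 x]] `|`
   [set tree_act g (mk 1 p) | g in [set g | tree_act g (mk t q) = mk 1 x]] `|`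
   [set z | retr v <> x /\ [set mk 1 y | y in
     [set y | e x y /\ exists2 m, m <= n & walk (del e x) m y (retr v)]] z])).
  move=> z [/asboolP [[g [a [b [ab xE ->]]]]|[g [xE ->]]|[g [-> xE]]] [m mn w]].
  - move/mkP: xE w => [c [-> xE]]; rewrite mul1g mk_i => w; right.
    have xb : e x (act c b) by rewrite xE actE.
    have bx : act c b <> x by move=> E; rewrite E irre in xb.
    have [vx [k km w']] := retr_avoid bx w; split=> //.
    exists (act c b) => //; split=> //; exists k => //.
    exact: leq_trans km mn.
  - by left; left; exists g; rewrite /= tree_actE ?mulg1.
  - by left; right; exists g; rewrite /= tree_actE ?mulg1.
rewrite !finite_setU; split; first split.
- by apply: to; apply: tree_stabilizer_compact; exact: stab_p_compact.
- by apply: to; apply: tree_stabilizer_compact; exact: stab_q_compact.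
(* Here [v] lies behind a bridge at [x], out of reach for walks in the complement of [x] that start
   in the copy. *)
have [->|rx] := pselect (retr v = x).
  by apply: (@sub_finite_set _ _ set0) => // z [].
apply: (@sub_finite_set _ _ [set mk 1 y | y in
     [set y | e x y /\ exists2 m, m <= n & walk (del e x) m y (retr v)]]).
  by move=> z [].
by apply: finite_image; apply: lf => /esym.
Qed.

Lemma tree_cocompact : cocompact_action e act -> cocompact_action tree_edge tree_act.
Proof.
move=> /(finite_of_cocompact act1 actM) [[R fR RP] [E fE EP]].
apply: (cocompact_of_finite tree_act1 tree_actM (R := mk 1 @` R)
  (E := ((fun x => (mk 1 x.1, mk 1 x.2)) @` E) `|`
    [set (mk 1 p, mk t q); (mk t q, mk 1 p)])).
- exact: finite_image.
- by rewrite finite_setU; split; [exact: finite_image | exact: finite_set2].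
- move=> u; have [g [x ->]] := mk_surj u; have [a [r [Rr ->]]] := RP x.
  exists (g * i a)%g, (mk 1 r); split; first by exists r.
  by rewrite tree_actE mulg1 mk_mulr.
move=> u v /asboolP
  [[g [x [y [/EP [a [b [c [Ebc -> ->]]]] -> ->]]]]|[g [-> ->]]|[g [-> ->]]].
- exists (g * i a)%g, (mk 1 b), (mk 1 c); rewrite !tree_actE mulg1 !mk_mulr.
  by split=> //; left; exists (b, c).
- by exists g, (mk 1 p), (mk t q); rewrite !tree_actE mulg1; split=> //; right; left.
- by exists g, (mk t q), (mk 1 p); rewrite !tree_actE mulg1; split=> //; right; right.
Qed.

Lemma tree_edge_compact u v : (forall x y, e x y -> compact (stabilizer act [set x; y])) ->
  tree_edge u v -> compact (stabilizer tree_act [set u; v]).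
Proof.
move=> edge_compact.
have st2 w z : compact (vertex_stabilizer tree_act w) ->
    compact (stabilizer tree_act [set w; z]).
  apply: (compact_stabilizer2 tree_act1 tree_actM) => ?; exact: tree_act_open.
have pc g : compact (vertex_stabilizer tree_act (mk g p)).
  by apply: tree_stabilizer_compact; exact: stab_p_compact.
move=> /asboolP [[g [x [y [/edge_compact cxy -> ->]]]]|[g [-> ->]]|[g [-> ->]]].
(* An element preserving an edge inside the copy [g A] preserves that copy, so it lies in
   [g A g^-1]. *)
- pose K := [set (h ^ g^-1)%g | h in i @` stabilizer act [set x; y]].
  apply: (@subclosed_compact _ _ K).
  + by apply: (stabilizer2_closed tree_act1 tree_actM) => ?; exact: tree_act_open.
  + apply: compact_conj; apply: compact_image_continuous cxy.
    exact: (hnn_continuous G_hnn).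
  move=> h; rewrite /stabilizer /= image_setU !image_set1 !tree_actE => E.
  have [a ha] : exists a, (h * g = g * i a)%g.
    have : [set mk g x; mk g y] (mk (h * g) x) by rewrite -E; left.
    case=> /mkP [a [ga _]]; exists a^-1%g;
      by rewrite multiplicativeV {2}ga mulgK.
  exists (i a); last by rewrite /conjg invgK mulgA -ha mulgK.
  exists a => //; move: E; rewrite ha !mk_mulr /stabilizer /= image_setU !image_set1.
  by move=> /set2_eq [[/mk_inj -> /mk_inj ->]|[/mk_inj -> /mk_inj ->]] //; rewrite setUC.
- exact: st2.
- by rewrite setUC; exact: st2.
Qed.

(* An element [g] outside [A] leads through an edge at [A], whose label is
   fixed by every [a] with [a g A = g A]. *)
Lemma compact_of_conj (H : set A) g : open_subgroup H ->
  (forall h, H h -> exists a, (g^-1 * i h * g)%g = i a) ->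
  ~ (exists a, g = i a) -> compact H.
Proof.
move=> oH Hg nA; case E: (side g) => [l|]; last by case: nA; exact/sideP.
apply: (@subclosed_compact _ _ (vertex_stabilizer act l.2)).
- exact: open_subgroup_closed.
- have [a [->|->]] := side_label E => /=; apply: compact_vertex_stabilizer => //.
    exact: stab_p_compact.
  exact: stab_q_compact.
move=> h /Hg [a ga]; have := side_mulr g a.
have -> : (g * i a = i h * g)%g by rewrite -ga -!mulgA mulVKg.
by rewrite side_mull E /= => -[] /(congr1 snd).
Qed.

End TreeGraph.
End Sides.
End HNN.

(** * The HNN extension as a topological group *)

Section OpenEmbedding.
Context {A G : topologicalGroupType} {i : {multiplicative A -> G}}.
Hypotheses (i_inj : injective i) (i_cont : continuous i).
Hypothesis i_open : forall U : set A, open U -> open (i @` U).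

Lemma image_open_subgroup (H : set A) : open_subgroup H -> open_subgroup (i @` H).
Proof.
move=> [sH oH]; split; last exact: i_open.
apply: subgroup_intro; first by exists 1%g; rewrite ?multiplicative1 //; exact: subgroup1.
move=> _ _ [a Ha <-] [b Hb <-]; exists (a / b)%g; first exact: subgroupF.
by rewrite gmulfM multiplicativeV.
Qed.

Lemma range_open_subgroup : open_subgroup (range i).
Proof.
apply: image_open_subgroup; split; last exact: openT.
by apply: subgroup_intro.
Qed.

Lemma translate_open (g : G) (U : set A) : open U ->
  open [set z | (i @` U) (g^-1 * z)%g].
Proof. by move=> oU; apply: preimage_mulgl_open; exact: i_open. Qed.

(** The image of [A] is an open subgroup, hence closed; so closedness passes from [A] to its cosets
    in [G]. *)
Lemma translate_closed (g : G) (F : set A) : closed F ->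
  closed [set z | (i @` F) (g^-1 * z)%g].
Proof.
move=> cF; rewrite -[mkset _]setCK; apply: open_closedC.
rewrite (_ : ~` _ = [set z | (i @` (~` F) `|` ~` range i) (g^-1 * z)%g]).
  apply: (@preimage_mulgl_open _ _ (i @` (~` F) `|` ~` range i)).
  apply: openU; first by apply: i_open; exact: closed_openC.
  by apply: closed_openC; apply: open_subgroup_closed; exact: range_open_subgroup.
apply/seteqP; split=> z /=.
  have [[a _ az]|] := pselect (range i (g^-1 * z)%g); last by right.
  by move=> nF; left; exists a => // Fa; apply: nF; exists a.
case=> [[a nFa az] [b Fb]|nR [b _ bz]]; last by apply: nR; exists b.
by rewrite -az => /i_inj E; apply: nFa; rewrite -E.
Qed.

Lemma open_embedding_hausdorff : hausdorff_space A -> hausdorff_space G.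
Proof.
rewrite !open_hausdorff => hA x y xy.
have sR := range_open_subgroup.1.
have [[a _ axy]|nR] := pselect (range i (x^-1 * y)%g).
  have [|[U U'] /= [U1 U'a] [oU oU' /eqP UU']] := hA 1%g a.
    apply: contra_neq xy => a1; move: axy; rewrite -a1 multiplicative1.
    by move=> /(congr1 (fun z => x * z)%g); rewrite mulg1 mulVKg.
  exists ([set z | (i @` U) (x^-1 * z)%g], [set z | (i @` U') (x^-1 * z)%g]).
    rewrite /= !inE /= in U1 U'a *; split; last by exists a.
    by exists 1%g; rewrite // mulVg multiplicative1.
  split=> /=; [exact: translate_open | exact: translate_open |].
  apply/eqP/seteqP; split=> // z /= [[b Ub bz] [c U'c]].
  rewrite -bz => /i_inj E; suff : (U `&` U') b by rewrite UU'.
  by split=> //; rewrite -E.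
exists ([set z | range i (x^-1 * z)%g], [set z | range i (y^-1 * z)%g]).
  by rewrite /= !inE /= !mulVg; split; exact: (subgroup1 sR).
split=> /=; [exact: translate_open openT | exact: translate_open openT |].
apply/eqP/seteqP; split=> // z /= [Rx Ry]; apply: nR.
have := subgroupF sR Rx Ry; rewrite invgM invgK.
by rewrite -mulgA mulVKg.
Qed.

Lemma open_embedding_totally_disconnected :
  totally_disconnected [set: A] -> totally_disconnected [set: G].
Proof.
move=> tA x _; pose B := connected_component [set: G] x.
have cB : connected B by exact: component_connected.
have Bx : B x by exact: connected_component_refl.
(* The coset of [x] is clopen, so the component stays inside it and can be pulled back to [A]. *)
have BR z : B z -> range i (x^-1 * z)%g.
  suff <- : B `&` [set z | range i (x^-1 * z)%g] = B by case.
  apply: cB.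
  - exists x; split=> //=; rewrite mulVg; exact: (subgroup1 range_open_subgroup.1).
  - by exists [set z | range i (x^-1 * z)%g] => //; exact: translate_open openT.
  - by exists [set z | range i (x^-1 * z)%g] => //; exact: translate_closed closedT.
pose B' := [set a | B (x * i a)%g].
have B'1 : B' 1%g by rewrite /B' /= multiplicative1 mulg1.
have cB' : connected B'.
  move=> D [d Dd] [O oO DO] [F cF DF].
  have DB E : D = B' `&` E -> [set z | (i @` D) (x^-1 * z)%g] =
      B `&` [set z | (i @` E) (x^-1 * z)%g].
    move=> ->; apply/seteqP; split=> z /=.
      move=> [a [B'a Ea] az]; split; last by exists a.
      by move: B'a; rewrite /B' /= az mulVKg.
    by move=> [Bz [a Ea az]]; exists a => //; split=> //; rewrite /B' /= az mulVKg.
  have EB : [set z | (i @` D) (x^-1 * z)%g] = B.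
    apply: cB.
    - by exists (x * i d)%g; exists d => //; rewrite mulKg.
    - by exists [set z | (i @` O) (x^-1 * z)%g]; [exact: translate_open | exact: DB].
    - by exists [set z | (i @` F) (x^-1 * z)%g]; [exact: translate_closed | exact: DB].
  apply/seteqP; split=> a; first by rewrite DO => -[].
  by rewrite /B' /= -EB /= mulKg => -[b Db /i_inj <-].
have B'sub : B' `<=` [set 1%g].
  by rewrite -(tA 1%g) //; apply: connected_component_max.
apply/seteqP; split=> [z Bz|_ ->] //=.
have [a _ az] := BR z Bz.
have /B'sub a1 : B' a by rewrite /B' /= az mulVKg.
by rewrite -[z](mulVKg x) -az a1 multiplicative1 mulg1.
Qed.

Lemma open_embedding_locally_compact : hausdorff_space G ->
  locally_compact [set: A] -> locally_compact [set: G].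
Proof.
move=> hG lA x _; have [//|U nU [cU _]] := lA 1%g.
have cK : compact [set (x * z)%g | z in i @` U].
  by apply: compact_mulgl; exact: compact_image_continuous.
exists [set (x * z)%g | z in i @` U]; last by split=> //; exact: compact_closed.
have [O [oO O1] OU] : exists2 O, open_nbhs 1%g O & O `<=` U.
  by move: nU; rewrite withinET nbhsE => -[O oO OU]; exists O.
suff : nbhs x [set z | (i @` O) (x^-1 * z)%g].
  rewrite withinET; apply: filterS => z [a Oa az]; exists (i a); last by rewrite az mulVKg.
  by exists a => //; exact: OU.
apply: open_nbhs_nbhs; split; first exact: translate_open.
by exists 1%g; rewrite // mulVg multiplicative1.
Qed.

Lemma open_embedding_tdlc : tdlc A -> tdlc G.
Proof.
move=> [hA tA lA]; have hG := open_embedding_hausdorff hA; split=> //.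
  exact: open_embedding_totally_disconnected.
exact: open_embedding_locally_compact.
Qed.

End OpenEmbedding.

Theorem theorem1p2 (A : topologicalGroupType) (HH : set (set A))
    (G : topologicalGroupType) (C : set A) (alpha : A -> A)
    (i : {multiplicative A -> G}) (t : G)
    (A_tdlc : tdlc A)
    (HH_finite : finite_set HH)
    (HH_open : forall H, HH H -> open_subgroup H)
    (A_generated : compactly_generated_relative HH)
    (G_hnn : hnn_extension C alpha i t)
    (A_hyperbolic : relatively_hyperbolic HH)
    (C_compact : compact C) :
  relatively_hyperbolic [set i @` H | H in HH].
Proof.
have [_ _ alpha_cont _] := hnn_iso G_hnn.
have cD : compact (alpha @` C) by exact: continuous_compact.
have := relatively_hyperbolic_add (hnn_image G_hnn) cD
  (relatively_hyperbolic_add (hnn_base G_hnn) C_compact A_hyperbolic).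
have [[_ _ _ HH_conj] _] := A_hyperbolic.
move=> [_ [V [e [act [CA /fineP lf he]]]]].
have [[syme irre] ce [act1 actM actE] coco disc cedge cvert cper corb] := CA.
have act_open x : open (vertex_stabilizer act x) by exact: open_of_discrete disc.
have [p stab_p] : exists p, vertex_stabilizer act p = C by apply: cper; left; right.
have [q stab_q] : exists q, vertex_stabilizer act q = alpha @` C by apply: cper; right.
have i_inj := hnn_injective G_hnn.
have i_cont := hnn_continuous G_hnn.
have i_open := hnn_open G_hnn.
have compact_i H : compact H -> compact (i @` H) by exact: compact_image_continuous.
(* If a conjugate by [g] of a non-compact [H] stays in [A], then [g] is in [A]; otherwise [H] would
   fix an edge of the tree. This gives both properness and the orbit condition. *)
have noncompact H g : HH H -> ~ compact (i @` H) ->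
    (forall h, H h -> exists a, (g^-1 * i h * g)%g = i a) -> exists a, g = i a.
  move=> HH_H ncH Hg; apply: contrapT => nA; apply: ncH; apply: compact_i.
  exact: (compact_of_conj G_hnn act1 actM stab_p stab_q C_compact (HH_open _ HH_H) Hg nA).
split.
  split.
  - exact: (open_embedding_tdlc i_inj i_cont i_open).
  - exact: finite_image.
  - by move=> _ [H HH_H <-]; apply: image_open_subgroup => //; exact: HH_open.
  move=> _ _ [H HH_H <-] [K HH_K <-] HK ncH ncK [g E].
  have [a ga] : exists a, g = i a.
    apply: (noncompact H) => // h Hh.
    have : (i @` K) (i h ^ g)%g by rewrite E; exists (i h) => //; exists h.
    by move=> [k _ kE]; exists k; rewrite kE /conjg mulgA.
  apply: (HH_conj H K) => //; [by move=> HKE; apply: HK; rewrite HKE | by move=> /compact_i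
    | by move=> /compact_i | exists a].
  have iJ h : i (h ^ a)%g = (i h ^ g)%g by rewrite ga /conjg !gmulfM multiplicativeV.
  apply/seteqP; split=> [k Kk|_ [h Hh <-]].
    have : (i @` K) (i k) by exists k.
    by rewrite E => -[_ [h Hh <-]]; rewrite -iJ => /i_inj <-; exists h.
  have : (i @` K) (i h ^ g)%g by rewrite E; exists (i h) => //; exists h.
  by rewrite -iJ => -[k Kk /i_inj <-].
pose ee := @tree_edge _ _ i t _ _ p q act1 actM e.
pose aa := @tree_act _ _ i _ _ act1 actM.
have aa1 : forall u, aa 1%g u = u by exact: tree_act1.
have aaM : forall g h u, aa (g * h)%g u = aa g (aa h u) by exact: tree_actM.
have aa_open u : open (vertex_stabilizer aa u) by exact: (tree_act_open G_hnn).
have stab_mk g x : vertex_stabilizer aa (mk act1 actM g x) =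
    [set (h ^ g^-1)%g | h in i @` vertex_stabilizer act x].
  by rewrite mk_tree_act (vertex_stabilizer_conj aa1 aaM) stabilizer_mk1.
exists (tree_vertex (i := i) act1 actM), ee, aa; split; last 2 first.
- by apply/fineP; apply: (tree_locally_fine G_hnn).
- exact: (tree_hyperbolic G_hnn).
split.
- by split; [exact: tree_edge_sym | exact: (tree_edge_irr G_hnn)].
- exact: (tree_connected G_hnn).
- by split=> //; exact: tree_actEdge.
- exact: tree_cocompact.
- exact: discrete_of_open.
- move=> _ [u [v [uv ->]]]; apply: (tree_edge_compact G_hnn stab_p act_open) uv => //.
  by move=> x y xy; apply: cedge; exists x, y.
- move=> u; have [g [x ->]] := mk_surj u.
  have small : compact (vertex_stabilizer act x) ->
      compact (vertex_stabilizer aa (mk act1 actM g x)).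
    exact: (tree_stabilizer_compact G_hnn).
  have [cx|[H HH_H [a xE]]] := cvert x; first by left; exact: small.
  (* Stabilizers coming from [C] and [alpha C] are compact, so the original collection suffices. *)
  case: HH_H xE => [[HH_H|->]|->] xE; last 2 first.
  + by left; apply: small; rewrite xE; exact: compact_conj.
  + by left; apply: small; rewrite xE; exact: compact_conj.
  right; exists (i @` H); first by exists H.
  exists (i a * g^-1)%g; rewrite stab_mk xE !image_comp; apply: eq_imagel => h _ /=.
  by rewrite conjgM /conjg !gmulfM multiplicativeV.
- move=> _ [H HH_H <-]; have [|x xH] := cper H; first by left; left.
  by exists (mk act1 actM 1%g x); rewrite stabilizer_mk1 xH.
move=> _ u v [H HH_H <-] ncH.
(* A non-compact peripheral stabilizer [i H] occurs only in the copy at [A], where the orbit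
   condition for [A] applies. *)
have toA w : vertex_stabilizer aa w = i @` H ->
    exists2 x, w = mk act1 actM 1%g x & vertex_stabilizer act x = H.
  have [g [x ->]] := mk_surj w => wH.
  have [b gb] : exists b, g = i b.
    apply: (noncompact H) => // h Hh.
    have : (i @` H) (i h) by exists h.
    rewrite -wH stab_mk => -[_ [a _ <-] ah]; exists a.
    by rewrite -ah /conjg invgK !mulgA mulVg mul1g mulgVK.
  exists (act b x); first by rewrite gb mk_i.
  move: wH; rewrite gb mk_i stabilizer_mk1 => E; apply/seteqP; split=> a.
    move=> ax; have : (i @` H) (i a) by rewrite -E; exists a.
    by move=> [a' Ha' /i_inj <-].
  move=> Ha; have : (i @` vertex_stabilizer act (act b x)) (i a) by rewrite E; exists a.
  by move=> [a' Ha' /i_inj <-].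
move=> /toA [x -> xH] /toA [y -> yH].
have [||a ->] := corb H x y _ _ xH yH; first by left; left.
  by move=> /compact_i.
by exists (i a); rewrite /aa tree_actE mulg1 mk_i.
Qed.
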